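(* Fix a finite signature $\tau$ and $k\in\mathbb{N}$. The query synthesis problem for $\mathrm{FO}(k)$ is decidable in $\mathsf{EXPTIME}$: there is an algorithm that, given pairs $\langle A_1,\mathit{Ans}_1\rangle,\dots,\langle A_m,\mathit{Ans}_m\rangle$ with each $A_i$ a finite $\tau$-structure and $\mathit{Ans}_i\subseteq\mathrm{dom}(A_i)^r$, and a regular tree grammar $G$ over $\Sigma_{\mathrm{FO}(k)}$, runs in time exponential in the input size and either outputs a formula $\varphi(x_1,\dots,x_r)\in L(G)$ with exactly $r$ distinct free (first-order) variables such that $\{\bar a\in\mathrm{dom}(A_i)^r: A_i\models\varphi(\bar a)\}=\mathit{Ans}_i$ for every $i\in\{1,\dots,m\}$, or correctly answers ''No'' if no such formula exists.
   Context: A signature $\tau$ consists of relation, function and constant symbols with arities; structures are finite. $\mathrm{FO}$ denotes first-order logic with if-then-else terms: formulas $\varphi::=R(\bar t)\mid\varphi\vee\varphi\mid\varphi\wedge\varphi\mid\neg\varphi\mid\exists x.\varphi\mid\forall x.\varphi$ and terms $t::=x\mid c\mid f(\bar t)\mid \mathsf{ite}(\varphi,t,t')$, where $\mathsf{ite}(\varphi,t_1,t_2)$ denotes the value of $t_1$ if $\varphi$ holds and of $t_2$ otherwise. $\mathrm{FO}(k)$ is the fragment using only the $k$ variables $V=\{x_1,\dots,x_k\}$ (which may be reused). Formulas are represented as finite ordered ranked trees over the finite ranked alphabet $\Sigma_{\mathrm{FO}(k)}=\{R^{\mathrm{ar}(R)}:R\in\tau\}\cup\{f^{\mathrm{ar}(f)}:f\in\tau\}\cup\{\mathsf{ite}^3\}\cup\{\wedge^2,\vee^2,\neg^1\}\cup\{\forall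 x^1,\exists x^1,x^0:x\in V\}$ (superscripts are arities). A regular tree grammar (RTG) $G=\langle N,\Sigma,S,P\rangle$ has nonterminals $N$, ranked alphabet $\Sigma$, axiom $S$ and rules $B\to t$ ($t$ a tree over $\Sigma\cup N$); $L(G)$ is the set of trees over $\Sigma$ derivable from $S$. *)

(* Defs.v *)
From Stdlib Require List.
From Stdlib Require Import Relation_Operators.
From mathcomp Require Import all_boot.

Set Implicit Arguments.
Unset Strict Implicit.
Unset Printing Implicit Defensive.

(** * First-order logic with if-then-else terms and k variables *)

(* Constants are the function symbols of arity 0. *)
Record signature := Signature {
  relsym : finType;
  rel_ar : relsym -> nat;
  funsym : finType;
  fun_ar : funsym -> nat }.

(* As usual in first-order logic, domains are nonempty. *)
Record structure (tau : signature) := Structure {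
  dom :> finType;
  dom_gt0 : 0 < #|dom|;
  rel_int : forall R : relsym tau, {set (rel_ar R).-tuple dom};
  fun_int : forall f : funsym tau, (fun_ar f).-tuple dom -> dom }.

(* The variable x_(i+1) of the paper is [i : 'I_k].  Equality is available only
   when the signature contains a symbol for it. *)
Inductive formula (tau : signature) (k : nat) : Type :=
| FRel (R : relsym tau) of ('I_(rel_ar R) -> term tau k)
| FOr of formula tau k & formula tau k
| FAnd of formula tau k & formula tau k
| FNot of formula tau k
| FEx of 'I_k & formula tau k
| FAll of 'I_k & formula tau k
with term (tau : signature) (k : nat) : Type :=
| TVar of 'I_k
| TFun (f : funsym tau) of ('I_(fun_ar f) -> term tau k)
| TIte of formula tau k & term tau k & term tau k.

Section Semantics.
Variables (tau : signature) (k : nat).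

Definition assignment (A : structure tau) := {ffun 'I_k -> dom A}.

Definition update (A : structure tau) (v : assignment A) (i : 'I_k) (a : A) :
    assignment A :=
  [ffun j => if j == i then a else v j].

Fixpoint sat (A : structure tau) (v : assignment A) (phi : formula tau k)
    {struct phi} : bool :=
  match phi with
  | FRel R ts => [tuple value v (ts i) | i < rel_ar R] \in rel_int A R
  | FOr p q => sat v p || sat v q
  | FAnd p q => sat v p && sat v q
  | FNot p => ~~ sat v p
  | FEx i p => [exists a : dom A, sat (update v i a) p]
  | FAll i p => [forall a : dom A, sat (update v i a) p]
  end
with value (A : structure tau) (v : assignment A) (t : term tau k)
    {struct t} : dom A :=
  match t with
  | TVar i => v i
  | TFun f ts => fun_int [tuple value v (ts i) | i < fun_ar f]
  | TIte p t1 t2 => if sat v p then value v t1 else value v t2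
  end.

Fixpoint fv (phi : formula tau k) : {set 'I_k} :=
  match phi with
  | FRel R ts => \bigcup_(i < rel_ar R) tfv (ts i)
  | FOr p q | FAnd p q => fv p :|: fv q
  | FNot p => fv p
  | FEx i p | FAll i p => fv p :\ i
  end
with tfv (t : term tau k) : {set 'I_k} :=
  match t with
  | TVar i => [set i]
  | TFun f ts => \bigcup_(i < fun_ar f) tfv (ts i)
  | TIte p t1 t2 => fv p :|: tfv t1 :|: tfv t2
  end.

(* The set of all r-tuples a with A |= phi(a), for phi with free variables among
   the first r ones; the values of the other variables are then irrelevant. *)
Definition answer_set (A : structure tau) (r : nat) (phi : formula tau k) :
    {set r.-tuple A} :=
  [set a : r.-tuple A | [exists v : assignment A,
     [forall i : 'I_k, (i < r) ==> (v i == nth (v i) a i)] && sat v phi]].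

End Semantics.

(** * The ranked alphabet of FO(k) and regular tree grammars over it *)

Inductive symbol (tau : signature) (k : nat) : Type :=
| SRel of relsym tau
| SFun of funsym tau
| SIte | SAnd | SOr | SNot
| SAll of 'I_k
| SEx of 'I_k
| SVar of 'I_k.

Arguments SIte {tau k}.
Arguments SAnd {tau k}.
Arguments SOr {tau k}.
Arguments SNot {tau k}.
Arguments SRel {tau k}.
Arguments SFun {tau k}.
Arguments SAll {tau k}.
Arguments SEx {tau k}.
Arguments SVar {tau k}.

Definition rank (tau : signature) (k : nat) (s : symbol tau k) : nat :=
  match s with
  | SRel R => rel_ar R
  | SFun f => fun_ar f
  | SIte => 3
  | SAnd | SOr => 2
  | SNot | SAll _ | SEx _ => 1
  | SVar _ => 0
  end.

Inductive rtree (tau : signature) (k : nat) (N : Type) : Type :=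
| Nonterm of N
| Op of symbol tau k & seq (rtree tau k N).

Arguments Nonterm {tau k N}.

Fixpoint well_ranked (tau : signature) (k : nat) (N : Type)
    (t : rtree tau k N) : bool :=
  match t with
  | Nonterm _ => true
  | Op s ts => (size ts == rank s) && all (@well_ranked tau k N) ts
  end.

Fixpoint formula_tree (tau : signature) (k : nat) (N : Type)
    (phi : formula tau k) : rtree tau k N :=
  match phi with
  | FRel R ts =>
      Op (SRel R) [seq term_tree N (ts i) | i <- enum 'I_(rel_ar R)]
  | FOr p q => Op SOr [:: formula_tree N p; formula_tree N q]
  | FAnd p q => Op SAnd [:: formula_tree N p; formula_tree N q]
  | FNot p => Op SNot [:: formula_tree N p]
  | FEx i p => Op (SEx i) [:: formula_tree N p]
  | FAll i p => Op (SAll i) [:: formula_tree N p]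
  end
with term_tree (tau : signature) (k : nat) (N : Type) (t : term tau k) :
    rtree tau k N :=
  match t with
  | TVar i => Op (SVar i) [::]
  | TFun f ts =>
      Op (SFun f) [seq term_tree N (ts i) | i <- enum 'I_(fun_ar f)]
  | TIte p t1 t2 =>
      Op SIte [:: formula_tree N p; term_tree N t1; term_tree N t2]
  end.

Record grammar (tau : signature) (k : nat) := Grammar {
  nonterm : finType;
  axiom : nonterm;
  rules : seq (nonterm * rtree tau k nonterm);
  rules_ranked : all (fun rl => well_ranked rl.2) rules }.

Inductive derives1 (tau : signature) (k : nat) (G : grammar tau k) :
    rtree tau k (nonterm G) -> rtree tau k (nonterm G) -> Prop :=
| derives1_rule B t :
    List.In (B, t) (rules G) -> derives1 (Nonterm B) t
| derives1_context s l t u l' :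
    derives1 t u -> derives1 (Op s (l ++ t :: l')) (Op s (l ++ u :: l')).

(* The tree of a formula has no nonterminal, so this is membership in L(G). *)
Definition in_language (tau : signature) (k : nat) (G : grammar tau k)
    (phi : formula tau k) : Prop :=
  clos_refl_trans _ (@derives1 tau k G)
    (Nonterm (axiom G)) (formula_tree (nonterm G) phi).

(** * Query synthesis *)

Record example (tau : signature) (r : nat) := Example {
  ex_struct : structure tau;
  ex_answers : {set r.-tuple ex_struct} }.

Record instance (tau : signature) (k : nat) := Instance {
  arity : nat;
  examples : seq (example tau arity);
  inst_grammar : grammar tau k }.

Definition is_solution (tau : signature) (k : nat) (I : instance tau k)
    (phi : formula tau k) : Prop :=
  [/\ in_language (inst_grammar I) phi,
      arity I <= k,
      fv phi = [set i : 'I_k | i < arity I] &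
      forall e, List.In e (examples I) ->
        answer_set (ex_struct e) (arity I) phi = ex_answers e].

Definition correct_output (tau : signature) (k : nat) (I : instance tau k)
    (o : option (formula tau k)) : Prop :=
  match o with
  | Some phi => is_solution I phi
  | None => forall phi, ~ is_solution I phi
  end.

(** * Machine model *)

(* First-order, call-by-value recursive functions over S-expressions with one
   atom: the language F of Jones, Computability and Complexity from a
   Programming Perspective, with several functions instead of one.  Running
   time is the number of evaluation rules applied.

   This time measure is polynomially related to Turing machine time.  Each rule
   allocates at most one cell and follows at most one pointer, and the only test
   is whether a value is the atom, so a Turing machine simulates t rules in time
   polynomial in t, representing values as pointers into a heap of t cells.
   Values are thus shared: a returned value may have more than t nodes when
   written out as a tree, but it is always given by a graph of at most t cells
   plus those of the input.  This matters here: the smallest formula solving a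
   query synthesis instance can have doubly exponential size as a tree. *)
Inductive sexp : Type := Atom | Cons of sexp & sexp.

Fixpoint sexp_size (d : sexp) : nat :=
  match d with
  | Atom => 1
  | Cons d1 d2 => (sexp_size d1 + sexp_size d2).+1
  end.

Definition car (d : sexp) : sexp := if d is Cons d1 _ then d1 else Atom.
Definition cdr (d : sexp) : sexp := if d is Cons _ d2 then d2 else Atom.
Definition is_cons (d : sexp) : bool := if d is Cons _ _ then true else false.

(* Variables are de Bruijn indices; every function takes one argument. *)
Inductive expr : Type :=
| EVar of nat
| EAtom
| ECons of expr & expr
| ECar of expr
| ECdr of expr
| EIf of expr & expr & expr
| ELet of expr & expr
| ECall of nat & expr.

(* The list of the bodies of the functions; the first one is the entry point. *)
Definition program := seq expr.

Definition body (P : program) (f : nat) : expr := nth EAtom P f.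

(* [eval P env e d t]: in the environment env, e evaluates to d in t steps. *)
Inductive eval (P : program) : seq sexp -> expr -> sexp -> nat -> Prop :=
| eval_var env n : eval P env (EVar n) (nth Atom env n) 1
| eval_atom env : eval P env EAtom Atom 1
| eval_cons env e1 e2 d1 d2 t1 t2 :
    eval P env e1 d1 t1 -> eval P env e2 d2 t2 ->
    eval P env (ECons e1 e2) (Cons d1 d2) (t1 + t2).+1
| eval_car env e d t :
    eval P env e d t -> eval P env (ECar e) (car d) t.+1
| eval_cdr env e d t :
    eval P env e d t -> eval P env (ECdr e) (cdr d) t.+1
| eval_if env e e1 e2 d d' t t' :
    eval P env e d t -> eval P env (if is_cons d then e1 else e2) d' t' ->
    eval P env (EIf e e1 e2) d' (t + t').+1
| eval_let env e1 e2 d1 d2 t1 t2 :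
    eval P env e1 d1 t1 -> eval P (d1 :: env) e2 d2 t2 ->
    eval P env (ELet e1 e2) d2 (t1 + t2).+1
| eval_call env f e d d' t t' :
    eval P env e d t -> eval P [:: d] (body P f) d' t' ->
    eval P env (ECall f e) d' (t + t').+1.

Lemma eval_deterministic (P : program) env e d t d' t' :
  eval P env e d t -> eval P env e d' t' -> d = d' /\ t = t'.
Proof.
move=> H; elim: H d' t' => {env e d t}.
- by move=> env n d' t' H; inversion H.
- by move=> env d' t' H; inversion H.
- move=> env e1 e2 d1 d2 t1 t2 _ IH1 _ IH2 d' t' H.
  inversion H as [| |? ? ? ? ? ? ? K1 K2| | | | |]; subst.
  by have [-> ->] := IH1 _ _ K1; have [-> ->] := IH2 _ _ K2.
- move=> env e d t _ IH d' t' H.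
  inversion H as [| | |? ? ? ? K| | | |]; subst.
  by have [-> ->] := IH _ _ K.
- move=> env e d t _ IH d' t' H.
  inversion H as [| | | |? ? ? ? K| | |]; subst.
  by have [-> ->] := IH _ _ K.
- move=> env e e1 e2 d d1 t t1 _ IH1 _ IH2 d' t' H.
  inversion H as [| | | | |? ? ? ? ? ? ? ? K1 K2| |]; subst.
  have [dE ->] := IH1 _ _ K1; rewrite -dE in K2.
  by have [-> ->] := IH2 _ _ K2.
- move=> env e1 e2 d1 d2 t1 t2 _ IH1 _ IH2 d' t' H.
  inversion H as [| | | | | |? ? ? ? ? ? ? K1 K2|]; subst.
  have [dE ->] := IH1 _ _ K1; rewrite -dE in K2.
  by have [-> ->] := IH2 _ _ K2.
- move=> env f e d d1 t t1 _ IH1 _ IH2 d' t' H.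
  inversion H as [| | | | | | |? ? ? ? ? ? ? K1 K2]; subst.
  have [dE ->] := IH1 _ _ K1; rewrite -dE in K2.
  by have [-> ->] := IH2 _ _ K2.
Qed.

Definition runs (P : program) (input output : sexp) (t : nat) : Prop :=
  eval P [:: input] (body P 0) output t.

(** * Encodings *)

(* Numbers are in unary.  They only stand for elements of explicitly given finite
   sets, for those sets' cardinalities, and for the arity r. *)
Fixpoint enc_nat (n : nat) : sexp :=
  if n is n'.+1 then Cons Atom (enc_nat n') else Atom.

Definition enc_elt (T : finType) (x : T) : sexp := enc_nat (enum_rank x).

Definition enc_seq (s : seq sexp) : sexp := foldr Cons Atom s.

Definition enc_tuple (T : finType) (r : nat) (a : r.-tuple T) : sexp :=
  enc_seq [seq enc_elt x | x <- a].

Definition enc_tuples (T : finType) (r : nat) (X : {set r.-tuple T}) : sexp :=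
  enc_seq [seq enc_tuple a | a <- enum X].

Definition enc_structure (tau : signature) (A : structure tau) : sexp :=
  Cons (enc_nat #|A|)
    (Cons (enc_seq [seq enc_tuples (rel_int A R) | R <- enum (relsym tau)])
          (enc_seq [seq enc_seq [seq Cons (enc_tuple a) (enc_elt (fun_int a))
                                | a <- enum {: (fun_ar f).-tuple A}]
                   | f <- enum (funsym tau)])).

Definition enc_symbol (tau : signature) (k : nat) (s : symbol tau k) : sexp :=
  match s with
  | SRel R => Cons (enc_nat 0) (enc_elt R)
  | SFun f => Cons (enc_nat 1) (enc_elt f)
  | SIte => Cons (enc_nat 2) Atom
  | SAnd => Cons (enc_nat 3) Atom
  | SOr => Cons (enc_nat 4) Atom
  | SNot => Cons (enc_nat 5) Atom
  | SAll i => Cons (enc_nat 6) (enc_nat i)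
  | SEx i => Cons (enc_nat 7) (enc_nat i)
  | SVar i => Cons (enc_nat 8) (enc_nat i)
  end.

Fixpoint enc_rtree (tau : signature) (k : nat) (N : finType)
    (t : rtree tau k N) : sexp :=
  match t with
  | Nonterm B => Cons Atom (enc_elt B)
  | Op s ts => Cons (enc_symbol s) (enc_seq [seq enc_rtree u | u <- ts])
  end.

Definition enc_grammar (tau : signature) (k : nat) (G : grammar tau k) : sexp :=
  Cons (enc_nat #|nonterm G|)
    (Cons (enc_elt (axiom G))
          (enc_seq [seq Cons (enc_elt rl.1) (enc_rtree rl.2) | rl <- rules G])).

Definition enc_example (tau : signature) (r : nat) (e : example tau r) : sexp :=
  Cons (enc_structure (ex_struct e)) (enc_tuples (ex_answers e)).

Definition enc_instance (tau : signature) (k : nat) (I : instance tau k) : sexp :=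
  Cons (enc_nat (arity I))
    (Cons (enc_seq [seq enc_example e | e <- examples I])
          (enc_grammar (inst_grammar I))).

(* "No" is the atom; a formula is output as its tree, boxed in a cell. *)
Definition enc_output (tau : signature) (k : nat) (o : option (formula tau k)) :
    sexp :=
  if o is Some phi then Cons (enc_rtree (formula_tree void phi)) Atom else Atom.

(* Main.v *)
(* Over the given structures, all that matters about a formula or a term is its
   state: its sort, its free variables and the table of its values at all
     points,
   a point being an example together with an assignment of its domain to the k
   variables.  The state of a tree is determined by its head symbol and the
     states
   of its children, and there are only exponentially many states.
   So one saturates
   a table that maps a nonterminal B and a state to one object with that state
   derivable from B: each round evaluates the right-hand sides in all possible
   ways, and as many rounds as there are possible keys reach a fixed point.  The
   answer is the entry for the axiom and the state that a solution must have.
   Witnesses are built by sharing and never inspected,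
     so that their size does not
   matter.  For the running time,
     the algorithm is written in a language in which
   all recursion is by folds: if the folds of a run iterate at most N times
     each,
   then the run takes time polynomial in N, and here N is exponential. *)
Require Import Defs.
From HB Require Import structures.
From Stdlib Require Import Relation_Operators Operators_Properties.
From mathcomp Require Import all_boot.
From mathcomp Require Import zify.
(* Imported again because [seq] shadows [Cons]. *)
Require Import Defs.

Set Implicit Arguments.
Unset Strict Implicit.
Unset Printing Implicit Defensive.

(** * A language of folds and its compilation *)

(** One witness per key is enough because states form a congruence: exchanging a subtree for another
    one with the same state, derived from the same nonterminal, changes neither the state nor the
    derivability of the whole tree. Values are recorded at all assignments to the [k] variables, not
    merely at [r]-tuples, because a quantifier reads the table of its body at updated assignments.

    As [tau] and [k] are fixed, the points are polynomially many and the keys number [2 ^ poly]. The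
    input size enters the exponent a second time through the right-hand sides: over a table with [m]
    entries, a tree of size [n] has at most [(m + 1) ^ n] evaluations. This is still a single
    exponential, and compilation, being polynomial in [N], keeps it so.

    The predicate [safe] is semantic: for a list fold it concerns only the accumulators that the
    fold reaches. The bounds on intermediate tables can therefore be drawn from their soundness. *)

Fixpoint sexp_eqb (x y : sexp) : bool :=
  match x, y with
  | Atom, Atom => true
  | Cons a b, Cons c d => sexp_eqb a c && sexp_eqb b d
  | _, _ => false
  end.

Lemma sexp_eqP : Equality.axiom sexp_eqb.
Proof.
move=> x y; apply: (iffP idP) => [|<-]; last by elim: x => //= a -> b ->.
by elim: x y => [|a IHa b IHb] [|c d] //= /andP[/IHa-> /IHb->].
Qed.

HB.instance Definition _ := hasDecEq.Build sexp sexp_eqP.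

Lemma leq_expl a b n : a <= b -> a ^ n <= b ^ n.
Proof. by case: n => // n le_ab; rewrite leq_exp2r. Qed.

Definition sbool (b : bool) : sexp := if b then Cons Atom Atom else Atom.

Fixpoint unlist (x : sexp) : seq sexp :=
  if x is Cons a d then a :: unlist d else [::].

Lemma enc_seqK : cancel enc_seq unlist.
Proof. by elim=> //= x s ->. Qed.

Lemma unlistK : cancel unlist enc_seq.
Proof. by elim=> //= x _ d ->. Qed.

Lemma is_cons_sbool b : is_cons (sbool b) = b.
Proof. by case: b. Qed.

Lemma sexp_size_gt0 x : 0 < sexp_size x.
Proof. by case: x. Qed.

Lemma size_unlist x : size (unlist x) <= sexp_size x.
Proof. by elim: x => //= a _ d IH; rewrite ltnS (leq_trans IH) ?leq_addl. Qed.

Lemma sexp_size_unlist x y : y \in unlist x -> sexp_size y < sexp_size x.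
Proof.
elim: x => //= a _ d IH; rewrite inE => /orP[/eqP->|/IH lt_yd].
  by rewrite ltnS leq_addr.
by rewrite ltnS (leq_trans (ltnW lt_yd)) ?leq_addl.
Qed.

Fixpoint tree_fold (F : sexp -> sexp -> sexp) (x : sexp) : sexp :=
  match x with
  | Atom => F Atom Atom
  | Cons a d =>
      F (Cons a d)
        ((fix children y :=
            if y is Cons u v then Cons (tree_fold F u) (children v) else Atom)
              d)
  end.

Lemma tree_foldE F x :
  tree_fold F x = F x (enc_seq [seq tree_fold F y | y <- unlist (cdr x)]).
Proof. by case: x => //= a d; congr F; elim: d => //= u _ v ->. Qed.

(* Programs in which recursion is restricted to folds.  The environment is one
   S-expression, the list of the values of the variables.  [CTree x b] folds x
   as an ordered tree, the children of a node being listed in its cdr. *)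
Inductive code : Type :=
| CEnv
| CAtom
| CCons of code & code
| CCar of code
| CCdr of code
| CIf of code & code & code
| CLet of code & code
| CFold of code & code & code
| CTree of code & code
| CEq of code & code.

Fixpoint run (c : code) (env : sexp) : sexp :=
  match c with
  | CEnv => env
  | CAtom => Atom
  | CCons a b => Cons (run a env) (run b env)
  | CCar a => car (run a env)
  | CCdr a => cdr (run a env)
  | CIf a b c => if is_cons (run a env) then run b env else run c env
  | CLet a b => run b (run a env)
  | CFold l z b =>
      foldr (fun x acc => run b (Cons x (Cons acc env))) (run z env)
        (unlist (run l env))
  | CTree x b =>
      tree_fold (fun y rs => run b (Cons y (Cons rs env))) (run x env)
  | CEq a b => sbool (run a env == run b env)
  end.

(* Every fold of a run iterates at most N times, and every comparison has an
   operand of size at most N: the run then takes time polynomial in N. *)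
Fixpoint safe (N : nat) (c : code) (env : sexp) : Prop :=
  match c with
  | CEnv | CAtom => True
  | CCons a b => safe N a env /\ safe N b env
  | CCar a | CCdr a => safe N a env
  | CIf a b c =>
      safe N a env /\ if is_cons (run a env) then safe N b env else safe N c env
  | CLet a b => safe N a env /\ safe N b (run a env)
  | CFold l z b =>
      [/\ safe N l env, safe N z env, size (unlist (run l env)) <= N &
        forall s1 x s2, unlist (run l env) = s1 ++ x :: s2 ->
          safe N b (Cons x (Cons (foldr
            (fun x acc => run b (Cons x (Cons acc env))) (run z env) s2) env))]
  | CTree x b =>
      [/\ safe N x env, sexp_size (run x env) <= N &
        forall y, sexp_size y <= sexp_size (run x env) ->
          safe N b (Cons y (Cons (enc_seq [seq tree_fold
            (fun y rs => run b (Cons y (Cons rs env))) z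
             | z <- unlist (cdr y)]) env))]
  | CEq a b => [/\ safe N a env, safe N b env & sexp_size (run a env) <= N]
  end.

(* Function 1 of a compiled program tests the equality of the two halves of its
   argument.  The functions below take the pair of the value that is folded and
   of the environment. *)
Definition eq_body : expr :=
  EIf (ECar (EVar 0))
    (EIf (ECdr (EVar 0))
       (EIf (ECall 1 (ECons (ECar (ECar (EVar 0))) (ECar (ECdr (EVar 0)))))
            (ECall 1 (ECons (ECdr (ECar (EVar 0))) (ECdr (ECdr (EVar 0)))))
            EAtom)
       EAtom)
    (EIf (ECdr (EVar 0)) EAtom (ECons EAtom EAtom)).

Definition fold_body (o : nat) (z b : expr) : expr :=
  EIf (ECar (EVar 0))
    (ELet (ECons (ECar (ECar (EVar 0)))
             (ECons (ECall o (ECons (ECdr (ECar (EVar 0))) (ECdr (EVar 0))))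
                (ECdr (EVar 0)))) b)
    (ELet (ECdr (EVar 0)) z).

Definition node_body (o : nat) (b : expr) : expr :=
  ELet (ECons (ECar (EVar 0))
          (ECons (ECall o.+1 (ECons (ECdr (ECar (EVar 0))) (ECdr (EVar 0))))
             (ECdr (EVar 0)))) b.

Definition children_body (o : nat) : expr :=
  EIf (ECar (EVar 0))
    (ECons (ECall o (ECons (ECar (ECar (EVar 0))) (ECdr (EVar 0))))
           (ECall o.+1 (ECons (ECdr (ECar (EVar 0))) (ECdr (EVar 0)))))
    EAtom.

(** * Evaluation with upper bounds on the number of steps *)

Definition evals P env e d (m : nat) : Prop :=
  exists2 t, eval P env e d t & t <= m.

Section Evals.
Variable P : program.

Lemma evals_le env e d m m' : m <= m' -> evals P env e d m ->
  evals P env e d m'.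
Proof. by move=> le_m [t ev le_t]; exists t => //; apply: leq_trans le_m. Qed.

Lemma evals_var env n d : d = nth Atom env n -> evals P env (EVar n) d 1.
Proof. by move->; exists 1 => //; constructor. Qed.

Lemma evals_atom env : evals P env EAtom Atom 1.
Proof. by exists 1 => //; constructor. Qed.

Lemma evals_cons env e1 e2 d1 d2 m1 m2 :
  evals P env e1 d1 m1 -> evals P env e2 d2 m2 ->
  evals P env (ECons e1 e2) (Cons d1 d2) (m1 + m2).+1.
Proof.
move=> [t1 E1 L1] [t2 E2 L2]; exists (t1 + t2).+1; last by lia.
exact: eval_cons.
Qed.

Lemma evals_car env e d d' m :
  evals P env e d m -> d' = car d -> evals P env (ECar e) d' m.+1.
Proof. by move=> [t E L] ->; exists t.+1 => //; apply: eval_car. Qed.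

Lemma evals_cdr env e d d' m :
  evals P env e d m -> d' = cdr d -> evals P env (ECdr e) d' m.+1.
Proof. by move=> [t E L] ->; exists t.+1 => //; apply: eval_cdr. Qed.

Lemma evals_if env e e1 e2 d d' m m' :
  evals P env e d m -> evals P env (if is_cons d then e1 else e2) d' m' ->
  evals P env (EIf e e1 e2) d' (m + m').+1.
Proof.
move=> [t1 E1 L1] [t2 E2 L2]; exists (t1 + t2).+1; last by lia.
exact: eval_if E1 E2.
Qed.

Lemma evals_then env e e1 e2 d d' m m' :
  evals P env e d m -> is_cons d -> evals P env e1 d' m' ->
  evals P env (EIf e e1 e2) d' (m + m').+1.
Proof. by move=> E1 dT E2; apply: evals_if E1 _; rewrite dT. Qed.

Lemma evals_else env e e1 e2 d d' m m' :
  evals P env e d m -> ~~ is_cons d -> evals P env e2 d' m' ->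
  evals P env (EIf e e1 e2) d' (m + m').+1.
Proof. by move=> E1 /negPf dF E2; apply: evals_if E1 _; rewrite dF. Qed.

Lemma evals_let env e1 e2 d1 d2 m1 m2 :
  evals P env e1 d1 m1 -> evals P (d1 :: env) e2 d2 m2 ->
  evals P env (ELet e1 e2) d2 (m1 + m2).+1.
Proof.
move=> [t1 E1 L1] [t2 E2 L2]; exists (t1 + t2).+1; last by lia.
exact: eval_let E1 E2.
Qed.

Lemma evals_call env f e d d' m m' :
  evals P env e d m -> evals P [:: d] (body P f) d' m' ->
  evals P env (ECall f e) d' (m + m').+1.
Proof.
move=> [t1 E1 L1] [t2 E2 L2]; exists (t1 + t2).+1; last by lia.
exact: eval_call E1 E2.
Qed.

End Evals.

Ltac evals_path :=
  match goal with
  | |- evals _ _ EAtom _ _ => exact: evals_atom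
  | |- evals _ _ (EVar _) _ _ => eapply evals_var; reflexivity
  | |- evals _ _ (ECons _ _) _ _ => eapply evals_cons; evals_path
  | |- evals _ _ (ECar _) _ _ => eapply evals_car; [evals_path | reflexivity]
  | |- evals _ _ (ECdr _) _ _ => eapply evals_cdr; [evals_path | reflexivity]
  end.

(** The test descends both values in lockstep and stops where either one ends, so its cost can be
    charged to the left operand alone. This is why [safe] bounds just one operand of a
    comparison. *)
Lemma eq_body_correct P x y :
  body P 1 = eq_body ->
  evals P [:: Cons x y] eq_body (sbool (x == y)) (40 * sexp_size x).
Proof.
move=> P1; elim: x y => [|a IHa d IHd] y.
  apply: (@evals_le _ _ _ _ (2 + (2 + (1 + 1).+1).+1).+1) => //.
  apply: evals_else; [evals_path | by [] |].
  case: y => [|b e].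
    apply: evals_else; [evals_path | by [] |].
    evals_path.
  apply: evals_then; [evals_path | by [] |].
  exact: evals_le (evals_atom _ _).
apply: (@evals_le _ _ _ _ (2 + (2 +
  (8 + 40 * sexp_size a + (8 + 40 * sexp_size d)).+1).+1).+1).
  by rewrite /=; lia.
apply: evals_then; [evals_path | by [] |].
case: y => [|b e].
  apply: evals_else; [evals_path | by [] |].
  by apply: (evals_le _ (evals_atom _ _)).
apply: evals_then; [evals_path | by [] |].
apply: evals_if.
  apply: (@evals_le _ _ _ _ ((3 + 3).+1 + 40 * sexp_size a).+1); first by lia.
  by apply: evals_call; [evals_path|rewrite P1].
rewrite is_cons_sbool; have ->
  : (Cons a d == Cons b e) = (a == b) && (d == e) by [].
case: ifP => _ /=; last by apply: (evals_le _ (evals_atom _ _)).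
apply: (@evals_le _ _ _ _ ((3 + 3).+1 + 40 * sexp_size d).+1); first by lia.
by apply: evals_call; [evals_path|rewrite P1].
Qed.

(** One parameter is both coefficient and exponent. For positive [N] the family absorbs sums,
    constants and multiplication by [N], so each compiled piece needs a single constant. *)
Definition polyb (k N : nat) : nat := k * N ^ k.

(** Calls use absolute indices, so the block [Q] is generated for a given offset [o] and must work
    whatever precedes it (with [eq_body] at index 1) and follows it. The constant [k] is chosen
    before [N] and the environment. Only the top of the target stack is read. *)
Definition compiled (c : code) : Prop :=
  forall o, 1 < o -> exists (Q : program) (e : expr) (k : nat),
  forall P1 P2, size P1 = o -> body P1 1 = eq_body ->
  forall N env stack, 0 < N -> safe N c env ->
  evals (P1 ++ Q ++ P2) (env :: stack) e (run c env) (polyb k N).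

Lemma polybD k1 k2 N : 0 < N -> polyb k1 N + polyb k2 N <= polyb (k1 + k2) N.
Proof.
move=> N0; rewrite /polyb mulnDl leq_add // leq_mul2l leq_pexp2l ?orbT //; lia.
Qed.

Lemma polybC k N : 0 < N -> k <= polyb k N.
Proof. by move=> N0; rewrite -{1}[k]muln1 leq_mul // expn_gt0 N0. Qed.

Lemma polybM k N : 0 < N -> N * polyb k N <= polyb k.+1 N.
Proof. by move=> N0; rewrite /polyb mulnCA -expnS leq_mul. Qed.

Lemma polyb_loop n k N :
  0 < N -> n <= N -> n * (polyb k N + 40) <= polyb (k + 40).+1 N.
Proof.
move=> N0 le_n; apply: leq_trans (polybM _ N0); apply: leq_mul => //.
by apply: leq_trans (polybD _ _ N0); rewrite leq_add2l polybC.
Qed.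

Lemma body_cat P1 P2 f : f < size P1 -> body (P1 ++ P2) f = body P1 f.
Proof. by move=> lt_f; rewrite /body nth_cat lt_f. Qed.

Lemma body_at P1 e P2 o : size P1 = o -> body (P1 ++ e :: P2) o = e.
Proof. by move=> <-; rewrite /body nth_cat ltnn subnn. Qed.

(** The linking argument common to the simple constructors: the two blocks are laid out one after
    the other. The second operand is available in every environment, which covers [CLet]; unary
    constructors are treated with a dummy second operand. *)
Lemma compile2 a b (F : expr -> expr -> expr) (c : code) :
  compiled a -> compiled b ->
  (forall ea eb k1 k2, exists k, forall P N env stack, 0 < N ->
     body P 1 = eq_body -> safe N c env ->
    (safe N a env -> evals P (env :: stack) ea (run a env) (polyb k1 N)) ->
    (forall env' stack', safe N b env' ->
       evals P (env' :: stack') eb (run b env') (polyb k2 N)) ->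
    evals P (env :: stack) (F ea eb) (run c env) (polyb k N)) ->
  compiled c.
Proof.
move=> Ca Cb H o o1.
have [Qa [ea [ka Ha]]] := Ca o o1.
have [|Qb [eb [kb Hb]]] := Cb (o + size Qa); first by lia.
have [k Hk] := H ea eb ka kb.
exists (Qa ++ Qb), (F ea eb), k => P1 P2 P1o P1eq N env stack N0 sf.
apply: Hk => //; rewrite ?body_cat ?P1o //.
  by rewrite -catA; apply: Ha.
move=> env' stack' sf'; rewrite -catA catA; apply: Hb;
  rewrite ?size_cat ?P1o //.
by rewrite body_cat ?P1o.
Qed.

(** The fold becomes a recursive function placed after the blocks of its parts. A function sees only
    its argument, so the environment travels with the remaining list and is rebound by a let. *)
Lemma compile_fold l z b :
  compiled l -> compiled z -> compiled b -> compiled (CFold l z b).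
Proof.
move=> Cl Cz Cb o o1.
have [Ql [el [kl Hl]]] := Cl o o1.
have [|Qz [ez [kz Hz]]] := Cz (o + size Ql); first by lia.
have [|Qb [eb [kb Hb]]] := Cb (o + size Ql + size Qz); first by lia.
set f := o + size Ql + size Qz + size Qb.
exists (Ql ++ Qz ++ Qb ++ [:: fold_body f ez eb]),
  (ECall f (ECons el (EVar 0))).
exists (kl + kz + (kb + 40).+1 + 40) => P1 P2 P1o P1eq N env stack N0 [sl sz
  le_N sb].
set P := P1 ++ _.
have Pf : body P f = fold_body f ez eb.
  have -> : P = (((P1 ++ Ql) ++ Qz) ++ Qb) ++ fold_body f ez eb :: P2.
    by rewrite /P -!catA.
  by apply: body_at; rewrite !size_cat; lia.
have {}Hz st : evals P (env :: st) ez (run z env) (polyb kz N).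
  have -> : P = (P1 ++ Ql) ++ Qz ++ (Qb ++ fold_body f ez eb :: P2).
    by rewrite /P -!catA.
  by apply: Hz => //; rewrite ?size_cat ?body_cat ?P1o.
have {}Hb env' st : safe N b env' ->
    evals P (env' :: st) eb (run b env') (polyb kb N).
  have -> : P = ((P1 ++ Ql) ++ Qz) ++ Qb ++ (fold_body f ez eb :: P2).
    by rewrite /P -!catA.
  move=> sb'; apply: Hb => //; rewrite ?body_cat ?size_cat ?P1o //; lia.
(* Safety is assumed for the suffixes of [y] only, which is what the induction on the remaining list
   can pass on. *)
have loop y : (forall s1 x s2, unlist y = s1 ++ x :: s2 -> safe N b
      (Cons x (Cons (foldr (fun x acc => run b (Cons x (Cons acc env)))
        (run z env) s2) env))) ->
    evals P [:: Cons y env] (body P f) (foldr (fun x acc =>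
      run b (Cons x (Cons acc env))) (run z env) (unlist y))
      (polyb kz N + 6 + size (unlist y) * (polyb kb N + 40)).
  elim: y => [|x _ y IHy] safe_y; rewrite Pf.
    apply: (@evals_le _ _ _ _ (2 + (2 + polyb kz N).+1).+1);
      first by rewrite /=; lia.
    apply: evals_else; [evals_path | by [] |].
    by apply: evals_let; [evals_path|apply: Hz].
  apply: (@evals_le _ _ _ _ (2 + ((3 + (((3 + 2).+1 + (polyb kz N + 6
     + size (unlist y) * (polyb kb N + 40))).+1 + 2).+1).+1 + polyb kb
       N).+1).+1).
    by rewrite /=; lia.
  apply: evals_then; [evals_path | by [] |].
  apply: evals_let; last by apply: Hb; apply: (safe_y [::]).
  apply: evals_cons; first by evals_path.
  apply: evals_cons; last by evals_path.
  apply: evals_call; first by evals_path.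
  by apply: IHy => s1 x' s2 yE; apply: (safe_y (x :: s1)); rewrite /= yE.
apply: (@evals_le _ _ _ _ ((polyb kl N + 1).+1 + (polyb kz N + 6 +
   size (unlist (run l env)) * (polyb kb N + 40))).+1); last first.
  apply: evals_call; last exact: loop.
  apply: evals_cons; last by evals_path.
  by rewrite /P -!catA; apply: Hl.
have := polybD kl kz N0; have := polybD (kl + kz) (kb + 40).+1 N0.
have := polybD (kl + kz + (kb + 40).+1) 40 N0; have := polybC 40 N0.
have := polyb_loop kb N0 le_N; lia.
Qed.

(** The nested recursion needs two mutually recursive functions, [f] for a node and [f.+1] for a
    list of children. Time is charged to the cells of the folded tree. *)
Lemma compile_tree x b : compiled x -> compiled b -> compiled (CTree x b).
Proof.
move=> Cx Cb o o1.
have [Qx [ex [kx Hx]]] := Cx o o1.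
have [|Qb [eb [kb Hb]]] := Cb (o + size Qx); first by lia.
set f := o + size Qx + size Qb.
exists (Qx ++ Qb ++ [:: node_body f eb; children_body f]),
  (ECall f (ECons ex (EVar 0))).
exists (kx + (kb + 40).+1 + 40) => P1 P2 P1o P1eq N env stack N0 [sx le_N sb].
set P := P1 ++ _.
have Pf : body P f = node_body f eb.
  have -> : P = ((P1 ++ Qx) ++ Qb) ++ node_body f eb :: children_body f :: P2.
    by rewrite /P -!catA.
  by apply: body_at; rewrite !size_cat; lia.
have Pf1 : body P f.+1 = children_body f.
  have -> : P = (((P1 ++ Qx) ++ Qb) ++ [:: node_body f eb]) ++ children_body f
    :: P2.
    by rewrite /P -!catA.
  by apply: body_at; rewrite !size_cat /=; lia.
have {}Hb env' st : safe N b env' ->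
    evals P (env' :: st) eb (run b env') (polyb kb N).
  have -> : P = (P1 ++ Qx) ++ Qb ++ (node_body f eb :: children_body f :: P2).
    by rewrite /P -!catA.
  by move=> sb'; apply: Hb => //; rewrite ?size_cat ?body_cat ?P1o.
pose F y rs := run b (Cons y (Cons rs env)).
pose nodes y := forall m, sexp_size y * (polyb kb N + 40) <= m ->
  sexp_size y <= sexp_size (run x env) ->
  evals P [:: Cons y env] (body P f) (tree_fold F y) m.
(* The predecessor matters at an atom, which is its own [cdr]: its empty list of children then costs
   only a constant, and the one unit that the atom owns pays for the body at that node. *)
pose children y := forall m, (sexp_size y).-1 * (polyb kb N + 40) + 5 <= m ->
  sexp_size y <= sexp_size (run x env) ->
  evals P [:: Cons y env] (body P f.+1)
    (enc_seq [seq tree_fold F z | z <- unlist y]) m.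
have node y : children (cdr y) -> nodes y.
  move=> IHc m le_m le_y.
  have le_c : sexp_size (cdr y) <= sexp_size y by case: (y) => //= ? ?; lia.
  rewrite Pf tree_foldE; apply: (@evals_le _ _ _ _ ((2 + ((((3 + 2).+1 +
    ((sexp_size (cdr y)).-1 * (polyb kb N + 40) + 5)).+1) + 2).+1).+1
    + polyb kb N).+1).
    apply: leq_trans le_m; case: (y) {IHc le_y le_c} => [|u v] /=; first by lia.
    have := sexp_size_gt0 u; have := sexp_size_gt0 v; nia.
  apply: evals_let; last by apply: Hb; apply: sb.
  apply: evals_cons; first by evals_path.
  apply: evals_cons; last by evals_path.
  by apply: evals_call; [evals_path|apply: IHc => //; apply: leq_trans le_y].
have child0 : children Atom.
  move=> m le_m _; rewrite Pf1; apply: (@evals_le _ _ _ _ (2 + 1).+1).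
    by rewrite /= in le_m; lia.
  by apply: evals_else; [evals_path | by [] | evals_path].
have loop : forall y, nodes y /\ children y.
  elim=> [|u [nu cu] v [nv cv]]; first by split=> //; apply: node.
  split; first exact: node.
  move=> m le_m le_y; rewrite Pf1.
  apply: (@evals_le _ _ _ _ (2 + (((3 + 2).+1 +
     sexp_size u * (polyb kb N + 40)).+1 + ((3 + 2).+1 +
     ((sexp_size v).-1 * (polyb kb N + 40) + 5)).+1).+1).+1).
    apply: leq_trans le_m => /=.
    have := sexp_size_gt0 u; have := sexp_size_gt0 v; nia.
  rewrite /= in le_y.
  apply: evals_then; [evals_path | by [] |].
  apply: evals_cons.
    by apply: evals_call; [evals_path | apply: nu => //; lia].
  by apply: evals_call; [evals_path | apply: cv => //; lia].
apply: (@evals_le _ _ _ _ ((polyb kx N + 1).+1 +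
  sexp_size (run x env) * (polyb kb N + 40)).+1); last first.
  apply: evals_call; last by apply: (loop _).1.
  apply: evals_cons; last by evals_path.
  by rewrite /P -!catA; apply: Hx.
have := polybD kx (kb + 40).+1 N0.
have := polybD (kx + (kb + 40).+1) 40 N0; have := polybC 40 N0.
have := polyb_loop kb N0 le_N; lia.
Qed.

Lemma compileP c : compiled c.
Proof.
elim: c.
- move=> o _; exists [::], (EVar 0), 1 => P1 P2 _ _ N env stack N0 _.
  by apply: (evals_le (polybC 1 N0)); evals_path.
- move=> o _; exists [::], EAtom, 1 => P1 P2 _ _ N env stack N0 _.
  by apply: (evals_le (polybC 1 N0)); evals_path.
- move=> a Ca b Cb; apply: (@compile2 _ _ (ECons) _ Ca Cb) => ea eb k1 k2.
  exists (k1 + k2 + 1) => P N env stack N0 _ [sa sb] Ha Hb.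
  apply: evals_le (evals_cons (Ha sa) (Hb _ _ sb)).
  have := polybD k1 k2 N0; have := polybD (k1 + k2) 1 N0.
  by have := polybC 1 N0; lia.
- move=> a Ca; apply: (@compile2 _ _ (fun e _ => ECar e) _ Ca Ca) => ea eb k1
  k2.
  exists (k1 + 1) => P N env stack N0 _ sa Ha _.
  apply: evals_le (evals_car (Ha sa) erefl).
  by have := polybD k1 1 N0; have := polybC 1 N0; lia.
- move=> a Ca; apply: (@compile2 _ _ (fun e _ => ECdr e) _ Ca Ca) => ea eb k1
  k2.
  exists (k1 + 1) => P N env stack N0 _ sa Ha _.
  apply: evals_le (evals_cdr (Ha sa) erefl).
  by have := polybD k1 1 N0; have := polybC 1 N0; lia.
- move=> a Ca b Cb c Cc.
  move=> o o1; have [Qa [ea [ka Ha]]] := Ca o o1.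
  have [|Qb [eb [kb Hb]]] := Cb (o + size Qa); first by lia.
  have [|Qc [ec [kc Hc]]] := Cc (o + size Qa + size Qb); first by lia.
  exists (Qa ++ Qb ++ Qc), (EIf ea eb ec), (ka + kb + kc + 1).
  move=> P1 P2 P1o P1eq N env stack N0 [sa sbc]; set P := P1 ++ _.
  have Eb : P = (P1 ++ Qa) ++ Qb ++ (Qc ++ P2) by rewrite /P -!catA.
  have Ec : P = ((P1 ++ Qa) ++ Qb) ++ Qc ++ P2 by rewrite /P -!catA.
  apply: (@evals_le _ _ _ _ (polyb ka N + (polyb kb N + polyb kc N)).+1).
    have := polybD ka kb N0; have := polybD (ka + kb) kc N0.
    by have := polybD (ka + kb + kc) 1 N0; have := polybC 1 N0; lia.
  apply: evals_if; first by rewrite /P -!catA; apply: Ha.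
  rewrite [run (CIf _ _ _) _]/=.
  case: ifP sbc => _ sbc.
    apply: evals_le (leq_addr _ _) _; rewrite Eb.
    by apply: Hb; rewrite ?body_cat ?size_cat ?P1o.
  apply: evals_le (leq_addl _ _) _; rewrite Ec.
  by apply: Hc; rewrite ?body_cat ?size_cat ?P1o //; lia.

- move=> a Ca b Cb; apply: (@compile2 _ _ (ELet) _ Ca Cb) => ea eb k1 k2.
  exists (k1 + k2 + 1) => P N env stack N0 _ [sa sb] Ha Hb.
  apply: evals_le (evals_let (Ha sa) (Hb _ _ sb)).
  have := polybD k1 k2 N0; have := polybD (k1 + k2) 1 N0.
  by have := polybC 1 N0; lia.
- by move=> l Cl z Cz b Cb; apply: compile_fold.
- by move=> x Cx b Cb; apply: compile_tree.
- move=> a Ca b Cb.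
  apply: (@compile2 _ _ (fun x y => ECall 1 (ECons x y)) _ Ca Cb) => ea eb k1
    k2.
  exists (k1 + k2 + 2 + 41) => P N env stack N0 Peq [sa sb le_N] Ha Hb.
  apply: evals_le (evals_call (evals_cons (Ha sa) (Hb _ _ sb)) _); last first.
    by rewrite Peq; apply: eq_body_correct.
  have := polybD k1 k2 N0; have := polybD (k1 + k2) 2 N0.
  have := polybD (k1 + k2 + 2) 41 N0; have := polybC 2 N0.
  have : 40 * sexp_size (run a env) <= polyb 41 N.
    apply: leq_trans (polybM 40 N0); rewrite mulnC.
    by apply: leq_mul => //; apply: polybC.
  lia.
Qed.

Lemma compile_program c : exists (P : program) (k : nat),
  forall N env, 0 < N -> safe N c env ->
  exists2 t, runs P env (run c env) t & t <= k * N ^ k.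
Proof.
have [Q [e [k H]]] := compileP c (isT : 1 < 2).
exists ([:: e; eq_body] ++ Q ++ [::]), k => N env N0 sf.
exact: (H [:: e; eq_body] [::]).
Qed.

(** * Lists in the language of folds *)

Definition CVar (n : nat) : code := CCar (iter n CCdr CEnv).

Definition CList (cs : seq code) : code := foldr CCons CAtom cs.

Definition CCall (f : code) (cs : seq code) : code := CLet (CList cs) f.

Definition CNth (i : nat) (l : code) : code := CCar (iter i CCdr l).

Definition CTrue : code := CCons CAtom CAtom.

Lemma run_CList cs env :
  run (CList cs) env = enc_seq [seq run c env | c <- cs].
Proof. by elim: cs => //= c cs ->. Qed.

Lemma safe_CList (T : eqType) (f : T -> code) s N env :
  {in s, forall x, safe N (f x) env} -> safe N (CList (map f s)) env.
Proof.
elim: s => //= x s IHs H; split; first by apply: H; rewrite mem_head.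
by apply: IHs => y ys; apply: H; rewrite inE ys orbT.
Qed.

Lemma run_CNth i l s env :
  run l env = enc_seq s -> run (CNth i l) env = nth Atom s i.
Proof.
rewrite /CNth /= => lE.
suff -> : run (iter i CCdr l) env = enc_seq (drop i s).
  by rewrite -[i in RHS]addn0 -nth_drop; case: drop.
elim: i => [|i IH] /=; first by rewrite drop0.
by rewrite IH -[in RHS]add1n -drop_drop; case: (drop i s) => //= x r;
  rewrite drop0.
Qed.

Lemma safe_CNth N i l env : safe N l env -> safe N (CNth i l) env.
Proof. by rewrite /CNth /= => sl; elim: i. Qed.

Opaque CNth.

Lemma size_unlist_enc s : size (unlist (enc_seq s)) = size s.
Proof. by rewrite enc_seqK. Qed.

(** Numerals are lists of atoms, so the range is built by a fold that applies the successor to all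
    entries and puts zero in front. *)
Definition c_range : code :=
  CFold (CVar 0) CAtom
    (CCons CAtom
       (CFold (CVar 1) CAtom (CCons (CCons CAtom (CVar 0)) (CVar 1)))).

Definition range (n : nat) : seq sexp := [seq enc_nat j | j <- iota 0 n].

Lemma rangeS n : range n.+1 = Atom :: [seq Cons Atom x | x <- range n].
Proof. by rewrite /range /= -[1]addn0 iotaDl -!map_comp. Qed.

Lemma size_range n : size (range n) = n.
Proof. by rewrite size_map size_iota. Qed.

Lemma nth_range n i : i < n -> nth Atom (range n) i = enc_nat i.
Proof. by move=> lt_i; rewrite (nth_map 0) ?size_iota // nth_iota. Qed.

Opaque range.

Lemma unlist_enc_nat n : unlist (enc_nat n) = nseq n Atom.
Proof. by elim: n => //= n ->. Qed.

Lemma foldr_enc_seq (f : sexp -> sexp) s :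
  foldr (fun x acc => Cons (f x) acc) Atom s = enc_seq (map f s).
Proof. by elim: s => //= x s ->. Qed.

Lemma run_range n : run c_range (enc_seq [:: enc_nat n]) = enc_seq (range n).
Proof.
rewrite /= unlist_enc_nat; elim: n => //= n ->.
by rewrite enc_seqK foldr_enc_seq rangeS.
Qed.

Lemma safe_range N n : n <= N -> safe N c_range (enc_seq [:: enc_nat n]).
Proof.
move=> le_N; split=> //=; rewrite unlist_enc_nat ?size_nseq //.
move=> s1 x s2 E; split=> //; split=> //.
have E2 : s2 = nseq (size s2) Atom.
  have := congr1 (drop (size s1).+1) E.
  rewrite -cat_rcons drop_size_cat ?size_rcons // => <-.
  by rewrite drop_nseq size_nseq.
have := run_range (size s2); rewrite /= unlist_enc_nat -E2 => ->.
rewrite size_unlist_enc size_range; apply: leq_trans le_N.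
by have := congr1 size E; rewrite size_nseq size_cat /=; lia.
Qed.
Opaque c_range.

Definition c_prod : code :=
  CFold (CVar 0) CAtom
    (CFold (CVar 3) (CVar 1) (CCons (CCons (CVar 2) (CVar 0)) (CVar 1))).

Definition prods (s t : seq sexp) : seq sexp := [seq Cons x y | x <- s, y <- t].

Lemma run_prod s t :
  run c_prod (enc_seq [:: enc_seq s; enc_seq t]) = enc_seq (prods s t).
Proof.
rewrite /= !enc_seqK /prods; elim: s => //= x s ->.
rewrite /enc_seq foldr_cat.
by elim: t [seq _ | _ <- _, _ <- _] => //= y t IHt u; rewrite IHt.
Qed.

Lemma safe_prod N s t : size s <= N -> size t <= N ->
  safe N c_prod (enc_seq [:: enc_seq s; enc_seq t]).
Proof.
by move=> le_s le_t; split=> //=; rewrite ?size_unlist_enc.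
Qed.

Opaque c_prod.

Definition c_assoc : code :=
  CFold (CVar 1) CAtom
    (CIf (CEq (CVar 2) (CCar (CVar 0))) (CCons (CCdr (CVar 0)) CAtom) (CVar 1)).

(* A value found is boxed in a cell, to be told apart from a failed search. *)
Definition assoc (key : sexp) (t : seq sexp) : sexp :=
  foldr (fun x acc => if key == car x then Cons (cdr x) Atom else acc) Atom t.

Lemma run_assoc key t :
  run c_assoc (enc_seq [:: key; enc_seq t]) = assoc key t.
Proof.
by rewrite /= enc_seqK; elim: t => //= x t ->; rewrite is_cons_sbool.
Qed.

Lemma safe_assoc N key t : size t <= N -> sexp_size key <= N ->
  safe N c_assoc (enc_seq [:: key; enc_seq t]).
Proof.
move=> le_t le_key; split=> //=; rewrite ?size_unlist_enc // => s1 x s2 _.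
by split=> //; case: ifP.
Qed.

Lemma assoc_map (T : eqType) (g f : T -> sexp) a s : injective g -> a \in s ->
  assoc (g a) [seq Cons (g x) (f x) | x <- s] = Cons (f a) Atom.
Proof.
move=> g_inj; elim: s => //= x s IHs; rewrite inE (inj_eq g_inj).
by case: eqP => //= ->.
Qed.

Opaque c_assoc.

Definition c_mem : code :=
  CFold (CVar 1) CAtom (CIf (CEq (CVar 2) (CVar 0)) CTrue (CVar 1)).

Lemma run_mem x s : run c_mem (enc_seq [:: x; enc_seq s]) = sbool (x \in s).
Proof.
rewrite /= enc_seqK; elim: s => //= y s ->.
by rewrite is_cons_sbool inE; case: (x == y).
Qed.

Lemma safe_mem N x s : size s <= N -> sexp_size x <= N ->
  safe N c_mem (enc_seq [:: x; enc_seq s]).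
Proof.
move=> le_s le_x; split=> //=; rewrite ?size_unlist_enc // => s1 y s2 _.
by split=> //; case: ifP.
Qed.

Opaque c_mem.

Definition c_map_car : code :=
  CFold (CVar 0) CAtom (CCons (CCar (CVar 0)) (CVar 1)).

Lemma run_map_car s :
  run c_map_car (enc_seq [:: enc_seq s]) = enc_seq (map car s).
Proof. by rewrite /= enc_seqK foldr_enc_seq. Qed.

Lemma safe_map_car N s : size s <= N ->
  safe N c_map_car (enc_seq [:: enc_seq s]).
Proof. by move=> le_s; split=> //=; rewrite size_unlist_enc. Qed.

Opaque c_map_car.

Definition c_map_cdr : code :=
  CFold (CVar 0) CAtom (CCons (CCdr (CVar 0)) (CVar 1)).

Lemma run_map_cdr s :
  run c_map_cdr (enc_seq [:: enc_seq s]) = enc_seq (map cdr s).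
Proof. by rewrite /= enc_seqK foldr_enc_seq. Qed.

Lemma safe_map_cdr N s : size s <= N ->
  safe N c_map_cdr (enc_seq [:: enc_seq s]).
Proof. by move=> le_s; split=> //=; rewrite size_unlist_enc. Qed.

Opaque c_map_cdr.

Fixpoint c_words (n : nat) : code :=
  if n is m.+1 then CCall c_prod [:: CVar 0; CCall (c_words m) [:: CVar 0]]
  else CCons CAtom CAtom.

Fixpoint words (n : nat) (D : seq sexp) : seq sexp :=
  if n is m.+1 then prods D (words m D) else [:: Atom].

Lemma run_words n D : run (c_words n) (enc_seq [:: enc_seq D]) = enc_seq (words
  n D).
Proof. by elim: n => //= n ->; apply: run_prod. Qed.

Lemma size_words n D : size (words n D) = size D ^ n.
Proof. by elim: n => //= n IHn; rewrite size_allpairs IHn expnS. Qed.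

(** The successor keeps the base positive, so the bound is monotone in [n] even when [D] is empty
    and covers the shorter words built on the way. *)
Lemma safe_words N n D : size D <= N -> (size D).+1 ^ n <= N ->
  safe N (c_words n) (enc_seq [:: enc_seq D]).
Proof.
move=> le_D; elim: n => // n IHn le_n.
have sn : (size D).+1 ^ n <= N.
  by apply: leq_trans le_n; rewrite leq_pexp2l.
split=> /=; first by do !split=> //; apply: IHn.
rewrite -/(enc_seq [:: enc_seq D]) (run_words n D).
apply: (@safe_prod N D (words n D)) => //; rewrite size_words.
by apply: leq_trans sn; apply: leq_expl.
Qed.

Lemma mem_words n D w :
  reflect (exists2 s, w = enc_seq s & size s = n /\ {subset s <= D})
    (w \in words n D).
Proof.
apply: (iffP idP).
  elim: n w => [|n IHn] w /=; first by rewrite inE => /eqP->; exists [::].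
  case/allpairsP=> -[x u] /= [xD /IHn[s -> [sz sD]] ->].
  exists (x :: s) => //; split=> /=; first by rewrite sz.
  by move=> y; rewrite inE => /orP[/eqP->|/sD].
case=> s -> [<-]; elim: s => //= x s IHs sD.
apply/allpairsP; exists (x, enc_seq s); split=> //=.
  by apply: sD; rewrite mem_head.
by apply: IHs => y ys; apply: sD; rewrite inE ys orbT.
Qed.

(** * States of formulas and terms *)

Scheme formula_term_ind := Induction for formula Sort Prop
with term_formula_ind := Induction for term Sort Prop.

Section Objects.
Variables (tau : signature) (k : nat).

(** Both sorts in one type: a nonterminal may derive formulas as well as terms, and the children of
    a node may be of different sorts. Head symbol and children then describe all nine constructors
    uniformly. *)
Inductive object : Type :=
| OForm of formula tau k
| OTerm of term tau k.

Implicit Types (o : object) (os : seq object) (s : symbol tau k).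

Definition is_form o : bool := if o is OForm _ then true else false.

Definition head_symbol o : symbol tau k :=
  match o with
  | OForm (FRel R _) => SRel R
  | OForm (FOr _ _) => SOr
  | OForm (FAnd _ _) => SAnd
  | OForm (FNot _) => SNot
  | OForm (FEx i _) => SEx i
  | OForm (FAll i _) => SAll i
  | OTerm (TVar i) => SVar i
  | OTerm (TFun f _) => SFun f
  | OTerm (TIte _ _ _) => SIte
  end.

Definition children o : seq object :=
  match o with
  | OForm (FRel R ts) => [seq OTerm (ts i) | i <- enum 'I_(rel_ar R)]
  | OForm (FOr p q) => [:: OForm p; OForm q]
  | OForm (FAnd p q) => [:: OForm p; OForm q]
  | OForm (FNot p) => [:: OForm p]
  | OForm (FEx _ p) => [:: OForm p]
  | OForm (FAll _ p) => [:: OForm p]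
  | OTerm (TVar _) => [::]
  | OTerm (TFun f ts) => [seq OTerm (ts i) | i <- enum 'I_(fun_ar f)]
  | OTerm (TIte p t u) => [:: OForm p; OTerm t; OTerm u]
  end.

Definition object_tree (N : Type) o : rtree tau k N :=
  match o with
  | OForm phi => formula_tree N phi
  | OTerm t => term_tree N t
  end.

Lemma object_treeE N o :
  object_tree N o = Op (head_symbol o) [seq object_tree N c | c <- children o].
Proof. by case: o => [[]|[]] //= *; rewrite -map_comp. Qed.

Definition enc_object o : sexp := enc_rtree (object_tree void o).

Lemma enc_objectE o :
  enc_object o =
  Cons (enc_symbol (head_symbol o)) (enc_seq [seq enc_object c | c <- children
    o]).
Proof. by rewrite {1}/enc_object object_treeE /= -map_comp. Qed.

Lemma object_children_ind (P : object -> Prop) :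
  (forall o, List.Forall P (children o) -> P o) -> forall o, P o.
Proof.
move=> H.
have args n (ts : 'I_n -> term tau k) : (forall i, P (OTerm (ts i))) ->
    List.Forall P [seq OTerm (ts i) | i <- enum 'I_n].
  by move=> Pts; elim: (enum _) => //= i s IHs; constructor.
have [HF HT] : (forall phi, P (OForm phi)) /\ (forall t, P (OTerm t)).
  split; [apply: (formula_term_ind (P := fun phi => P (OForm phi))
            (P0 := fun t => P (OTerm t)))
         |apply: (term_formula_ind (P := fun phi => P (OForm phi))
            (P0 := fun t => P (OTerm t)))] => *; apply: H => /=;
  by [apply: args | repeat constructor].
by case.
Qed.

Definition arg_sorts s : seq bool :=
  match s with
  | SRel R => nseq (rel_ar R) false
  | SFun f => nseq (fun_ar f) false
  | SIte => [:: true; false; false]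
  | SAnd | SOr => [:: true; true]
  | SNot | SAll _ | SEx _ => [:: true]
  | SVar _ => [::]
  end.

Definition out_sort s : bool :=
  match s with SFun _ | SIte | SVar _ => false | _ => true end.

Lemma is_formE o : is_form o = out_sort (head_symbol o).
Proof. by case: o => [[]|[]]. Qed.

Lemma map_const (T1 T2 : Type) (x : T2) (s : seq T1) : [seq x | _ <- s] = nseq
  (size s) x.
Proof. by elim: s => //= _ s ->. Qed.

Lemma children_sorts o : map is_form (children o) = arg_sorts (head_symbol o).
Proof.
by case: o => [[]|[]] //= *; rewrite -map_comp map_const size_enum_ord.
Qed.

Lemma terms_of_sorts n os : map is_form os = nseq n false ->
  exists ts : 'I_n -> term tau k, os = [seq OTerm (ts i) | i <- enum 'I_n].
Proof.
move=> sorts; have [ss osE] : exists ss, os = map OTerm ss.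
  elim: os n sorts => [|o os IHos] [|n] //=; first by exists [::].
  by case: o => // t [/IHos[ss ->]]; exists (t :: ss).
have : size ss = n by rewrite -(size_map OTerm) -osE -(size_map is_form) sorts
  size_nseq.
case: n / {sorts}; exists (tnth (in_tuple ss)).
transitivity (map OTerm [seq tnth (in_tuple ss) i | i <- enum 'I_(size ss)]).
  by rewrite map_tnth_enum osE.
by rewrite -map_comp.
Qed.

(** Converse of [children_sorts]: sorts are the only obstruction to putting a symbol above given
    children. The length of [arg_sorts s] being the rank of [s], comparing sorts checks the number
    of children as well. *)
Lemma object_of_children s os : map is_form os = arg_sorts s ->
  exists o, head_symbol o = s /\ children o = os.
Proof.
case: s => [R|f| | | | |i|i|i] /=.
- by case/terms_of_sorts=> ts ->; exists (OForm (FRel ts)).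
- by case/terms_of_sorts=> ts ->; exists (OTerm (TFun ts)).
- by case: os => [|[p|?] [|[?|t] [|[?|u] []]]] // _;
  exists (OTerm (TIte p t u)).
- by case: os => [|[p|?] [|[q|?] []]] // _; exists (OForm (FAnd p q)).
- by case: os => [|[p|?] [|[q|?] []]] // _; exists (OForm (FOr p q)).
- by case: os => [|[p|?] []] // _; exists (OForm (FNot p)).
- by case: os => [|[p|?] []] // _; exists (OForm (FAll i p)).
- by case: os => [|[p|?] []] // _; exists (OForm (FEx i p)).
- by case: os => // _; exists (OTerm (TVar _ i)).
Qed.

Definition free_vars o : {set 'I_k} :=
  match o with OForm phi => fv phi | OTerm t => tfv t end.

Definition binds s (i : 'I_k) : bool :=
  match s with SEx j | SAll j => j == i | _ => false end.

Definition is_var s (i : 'I_k) : bool := if s is SVar j then j == i else false.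

Lemma free_varsE o i : (i \in free_vars o) =
  is_var (head_symbol o) i || ~~ binds (head_symbol o) i &&
    has (fun c => i \in free_vars c) (children o).
Proof.
have args n (ts : 'I_n -> term tau k) : (i \in \bigcup_(j < n) tfv (ts j)) =
    has (fun c => i \in free_vars c) [seq OTerm (ts j) | j <- enum 'I_n].
  rewrite has_map; apply/bigcupP/hasP => [[j _ ij]|[j _ ij]]; exists j => //.
  by rewrite mem_enum.
by case: o => [[]|[]] //= *; rewrite ?args // ?inE ?orbF ?orbA // eq_sym.
Qed.

Definition eval_object (A : structure tau) (v : assignment k A) o : sexp :=
  match o with
  | OForm phi => sbool (sat v phi)
  | OTerm t => enc_elt (value v t)
  end.

End Objects.

Arguments is_form {tau k}.

Lemma enc_nat_inj : injective enc_nat.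
Proof. by elim=> [|m IHm] [|n] //= [/IHm->]. Qed.

Lemma enc_elt_inj (T : finType) : injective (@enc_elt T).
Proof. by move=> x y /enc_nat_inj/val_inj/enum_rank_inj. Qed.

Lemma enc_seq_inj : injective enc_seq.
Proof. exact: can_inj enc_seqK. Qed.

Lemma enc_tuple_inj (T : finType) n : injective (@enc_tuple T n).
Proof. by move=> x y /enc_seq_inj/(inj_map (@enc_elt_inj T))/val_inj. Qed.

Lemma range_card (T : finType) : range #|T| = [seq enc_elt x | x <- enum T].
Proof.
apply: (@eq_from_nth _ Atom); rewrite size_range ?size_map;
  first by rewrite cardT enumT.
move=> i lt_i.
pose x := enum_val (Ordinal lt_i).
rewrite (nth_map x) ?nth_range //; last by rewrite -cardE.
by rewrite -[nth _ _ _](enum_val_nth x (Ordinal lt_i)) /enc_elt enum_valK.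
Qed.

(** * Computing the value of a node at a point from the states of its children *)

Section Values.
Variables (tau : signature) (k : nat).
Notation symbol := (symbol tau k).

Definition enc_asg (A : structure tau) (v : assignment k A) : sexp :=
  enc_seq [seq enc_elt (v i) | i <- enum 'I_k].

(** A point carries its whole encoded example: the code reads the domain, the interpretations and
    the answers from it, and it also serves as the index into tables. *)
Definition point (r : nat) (e : example tau r) (v : assignment k (ex_struct e))
  :
  sexp := Cons (enc_example e) (enc_asg v).

Definition c_table (j : nat) (args : code) : code := CCdr (CCdr (CNth j args)).

Definition c_look (j : nat) (p args : code) : code :=
  CCar (CCall c_assoc [:: p; c_table j args]).

Definition c_dom (p : code) : code := CCar (CCar (CCar p)).
Definition c_rel (R : relsym tau) (p : code) : code :=
  CNth (enum_rank R) (CCar (CCdr (CCar (CCar p)))).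
Definition c_fun (f : funsym tau) (p : code) : code :=
  CNth (enum_rank f) (CCdr (CCdr (CCar (CCar p)))).

Definition c_args (n : nat) : code :=
  CList [seq c_look (val i) (CVar 0) (CVar 1) | i <- enum 'I_n].

(** Meant for the body of a fold over the domain, where variables 0 and 1 are the element and the
    accumulator; the point is then variable 2. *)
Definition c_update (i : 'I_k) : code :=
  CCons (CCar (CVar 2))
    (CList [seq if j == i then CVar 0 else CNth (val j) (CCdr (CVar 2))
           | j <- enum 'I_k]).

(* The environment holds a point and the states of the children; the result is
   the value at this point of the object with the given head symbol. *)
Definition c_value (s : symbol) : code :=
  match s with
  | SRel R => CCall c_mem [:: c_args (rel_ar R); c_rel R (CVar 0)]
  | SFun f => CCar (CCall c_assoc [:: c_args (fun_ar f); c_fun f (CVar 0)])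
  | SIte => CIf (c_look 0 (CVar 0) (CVar 1)) (c_look 1 (CVar 0) (CVar 1))
                (c_look 2 (CVar 0) (CVar 1))
  | SAnd => CIf (c_look 0 (CVar 0) (CVar 1)) (c_look 1 (CVar 0) (CVar 1)) CAtom
  | SOr => CIf (c_look 0 (CVar 0) (CVar 1)) CTrue (c_look 1 (CVar 0) (CVar 1))
  | SNot => CIf (c_look 0 (CVar 0) (CVar 1)) CAtom CTrue
  | SAll i => CFold (CCall c_range [:: c_dom (CVar 0)]) CTrue
                (CIf (c_look 0 (c_update i) (CVar 3)) (CVar 1) CAtom)
  | SEx i => CFold (CCall c_range [:: c_dom (CVar 0)]) CAtom
                (CIf (c_look 0 (c_update i) (CVar 3)) CTrue (CVar 1))
  | SVar i => CNth (val i) (CCdr (CVar 0))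
  end.

Variables (r : nat) (exs : seq (example tau r)) (pts : seq sexp).
Hypothesis pts_point : forall e v, List.In e exs -> @point r e v \in pts.

Definition free_bits (o : object tau k) : sexp :=
  enc_seq [seq sbool (i \in free_vars o) | i <- enum 'I_k].

Definition table (f : sexp -> sexp) : sexp :=
  enc_seq [seq Cons p (f p) | p <- pts].

(** The function [f] takes encoded points, not pairs of an example and an assignment: examples with
    the same encoding share their points, and one table entry must be right for all of them. *)
Definition is_state (st : sexp) (o : object tau k) : Prop :=
  exists2 f, st = Cons (sbool (is_form o)) (Cons (free_bits o) (table f)) &
    forall e v, List.In e exs -> f (@point r e v) = eval_object v o.

Definition are_states (sts : seq sexp) (os : seq (object tau k)) : Prop :=
  List.Forall2 is_state sts os.

Lemma Forall2_nth (T1 T2 : Type) (Q : T1 -> T2 -> Prop) s1 s2 x1 x2 i :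
  List.Forall2 Q s1 s2 -> i < size s2 -> Q (nth x1 s1 i) (nth x2 s2 i).
Proof. by move=> H; elim: H i => {s1 s2} // ? ? ? ? ? ? IH [|i] //= /IH. Qed.

Definition example_le (N : nat) (e : example tau r) : Prop :=
  [/\ #|ex_struct e| <= N,
      forall v : assignment k (ex_struct e), sexp_size (point v) <= N,
      forall R, #|rel_int (ex_struct e) R| <= N /\
        forall a : (rel_ar R).-tuple (ex_struct e),
          sexp_size (enc_tuple a) <= N &
      forall f : funsym tau, #|{: (fun_ar f).-tuple (ex_struct e)}| <= N /\
        forall a : (fun_ar f).-tuple (ex_struct e),
          sexp_size (enc_tuple a) <= N].

Section Look.
Variables (e : example tau r) (v : assignment k (ex_struct e)).
Variables (sts : seq sexp) (os : seq (object tau k)).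
Hypotheses (e_exs : List.In e exs) (states : are_states sts os).
Variables (N : nat).
Hypothesis le_pts : size pts <= N.

(** The assignment [u] is independent of the point under evaluation; the quantifiers use it with an
    updated assignment, whose point is in the table by [pts_point]. *)
Lemma run_look (u : assignment k (ex_struct e)) j p args env o0 :
  j < size os -> run p env = point u -> run args env = enc_seq sts ->
  run (c_look j p args) env = eval_object u (nth o0 os j).
Proof.
move=> lt_j pE argsE.
have [f stE fE] := Forall2_nth Atom o0 states lt_j.
change (car (run c_assoc (enc_seq [:: run p env;
  cdr (cdr (run (CNth j args) env))])) = eval_object u (nth o0 os j)).
rewrite (run_CNth j argsE) pE stE run_assoc.
by rewrite (@assoc_map _ id) //= ?fE //; apply: pts_point.
Qed.

Lemma safe_look (u : assignment k (ex_struct e)) j p args env :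
  j < size os -> run p env = point u -> run args env = enc_seq sts ->
  safe N p env -> safe N args env ->
  sexp_size (point u) <= N -> safe N (c_look j p args) env.
Proof.
move=> lt_j pE argsE sp sa le_u.
have [o0 _] : exists o0 : object tau k, True by case: os lt_j => // o; exists o.
have [f stE fE] := Forall2_nth Atom o0 states lt_j.
split; first by split=> //; split=> //; apply: (@safe_CNth N j args env).
change (safe N c_assoc (enc_seq [:: run p env;
  cdr (cdr (run (CNth j args) env))])).
by rewrite (run_CNth j argsE) pE stE; apply: safe_assoc; rewrite ?size_map.
Qed.

Opaque c_look.

Lemma run_args n (ts : 'I_n -> term tau k) :
  os = [seq OTerm (ts i) | i <- enum 'I_n] ->
  run (c_args n) (enc_seq [:: point v; enc_seq sts]) =
  enc_tuple [tuple value v (ts i) | i < n].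
Proof.
move=> osE; rewrite run_CList /enc_tuple -!map_comp.
congr enc_seq; apply: eq_map => i.
transitivity (run (c_look i (CVar 0) (CVar 1)) (enc_seq [:: point v;
  enc_seq sts])) => //.
have lt_i : i < size os by rewrite osE size_map size_enum_ord.
rewrite (run_look (u := v) (OTerm (ts i)) lt_i) // osE.
by rewrite (nth_map i) ?size_enum_ord // nth_ord_enum.
Qed.

Lemma run_update i a w q :
  run (c_update i) (Cons (enc_elt a) (Cons w (Cons (point v) q))) =
  point (update v i a).
Proof.
rewrite /point /=; congr Cons; rewrite run_CList -map_comp.
congr enc_seq; apply: eq_map => j /=; rewrite ffunE; case: eqP => // _.
rewrite (@run_CNth _ _ ([seq enc_elt (v i) | i <- enum 'I_k])) //.
by rewrite (nth_map j) ?size_enum_ord // nth_ord_enum.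
Qed.

Lemma run_rel R :
  run (c_rel R (CVar 0)) (enc_seq [:: point v; enc_seq sts]) =
  enc_tuples (rel_int (ex_struct e) R).
Proof.
rewrite (@run_CNth _ _ ([seq enc_tuples (rel_int (ex_struct e) R) | R <- enum
  (relsym tau)])) //.
by rewrite (nth_map R) -?cardE ?ltn_ord // nth_enum_rank.
Qed.

Lemma run_fun f :
  run (c_fun f (CVar 0)) (enc_seq [:: point v; enc_seq sts]) =
  enc_seq [seq Cons (enc_tuple a) (enc_elt (@fun_int _ (ex_struct e) _ a))
          | a <- enum {: (fun_ar f).-tuple (ex_struct e)}].
Proof.
rewrite (@run_CNth _ _ ([seq enc_seq [seq Cons (enc_tuple a) (enc_elt (fun_int
  a))
                                | a <- enum {: (fun_ar f).-tuple (ex_struct e)}]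
                   | f <- enum (funsym tau)])) //.
by rewrite (nth_map f) -?cardE ?ltn_ord // nth_enum_rank.
Qed.

Lemma run_value o : os = children o ->
  run (c_value (head_symbol o)) (enc_seq [:: point v; enc_seq sts]) =
  eval_object v o.
Proof.
have look j o0 : j < size os ->
   run (c_look j (CVar 0) (CVar 1)) (enc_seq [:: point v; enc_seq sts])
   = eval_object v (nth o0 os j) by move=> lt_j; apply: run_look.
have look_upd j o0 i a w : j < size os ->
   run (c_look j (c_update i) (CVar 3))
     (Cons (enc_elt a) (Cons w (enc_seq [:: point v; enc_seq sts])))
   = eval_object (update v i a) (nth o0 os j).
  move=> lt_j; apply: run_look => //; exact: run_update.
have dom_range : unlist (run c_range (enc_seq [:: enc_nat #|ex_struct e|])) =
    [seq enc_elt a | a <- enum (ex_struct e)].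
  by rewrite run_range enc_seqK range_card.
case: o => [[R ts|p q|p q|p|i p|i p]|[i|f ts|p t u]] osE;
  rewrite [head_symbol _]/=.
- transitivity (run c_mem (enc_seq [:: run (c_args (rel_ar R))
     (enc_seq [:: point v; enc_seq sts]); run (c_rel R (CVar 0))
     (enc_seq [:: point v; enc_seq sts])])) => //.
  by rewrite (run_args osE) run_rel run_mem (mem_map (@enc_tuple_inj _ _))
    mem_enum.
- rewrite /= !(look _ (OForm p)) osE //=.
  by rewrite !is_cons_sbool; case: (sat v p).
- rewrite /= !(look _ (OForm p)) osE //=.
  by rewrite !is_cons_sbool; case: (sat v p).
- rewrite /= !(look _ (OForm p)) osE //=.
  by rewrite !is_cons_sbool; case: (sat v p).
- rewrite /= dom_range.
  have -> : [exists a, sat (update v i a) p] =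
      has (fun a => sat (update v i a) p) (enum (ex_struct e)).
    by apply/existsP/hasP => [[a pa]|[a _ pa]]; exists a; rewrite ?mem_enum.
  elim: (enum _) => //= a s ->; rewrite (look_upd _ (OForm p)) osE //=.
  by rewrite is_cons_sbool; case: (sat _ p).
- rewrite /= dom_range.
  have -> : [forall a, sat (update v i a) p] =
      all (fun a => sat (update v i a) p) (enum (ex_struct e)).
    by apply/forallP/allP => [pa a _|pa a]; apply: pa; rewrite ?mem_enum.
  elim: (enum _) => //= a s ->; rewrite (look_upd _ (OForm p)) osE //=.
  by rewrite is_cons_sbool; case: (sat _ p).
- rewrite (@run_CNth _ _ [seq enc_elt (v i) | i <- enum 'I_k]) //=.
  by rewrite (nth_map i) ?size_enum_ord // nth_ord_enum.
- transitivity (car (run c_assoc (enc_seq [:: run (c_args (fun_ar f))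
     (enc_seq [:: point v; enc_seq sts]); run (c_fun f (CVar 0))
     (enc_seq [:: point v; enc_seq sts])]))) => //.
  rewrite (run_args osE) run_fun run_assoc assoc_map ?mem_enum //.
  exact: enc_tuple_inj.
- rewrite /= !(look _ (OForm p)) osE //=.
  by rewrite !is_cons_sbool; case: (sat v p).
Qed.

Lemma safe_value o : os = children o -> example_le N e ->
  safe N (c_value (head_symbol o)) (enc_seq [:: point v; enc_seq sts]).
Proof.
move=> osE [le_dom le_pt le_rel le_fun].
have look j : j < size os -> safe N (c_look j (CVar 0) (CVar 1))
     (enc_seq [:: point v; enc_seq sts]).
  by move=> lt_j; apply: safe_look (le_pt _).
have look_upd j i (a : ex_struct e) w : j < size os ->
    safe N (c_look j (c_update i) (CVar 3))
     (Cons (enc_elt a) (Cons w (enc_seq [:: point v; enc_seq sts]))).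
  move=> lt_j; apply: (safe_look lt_j _ _ _ _ (le_pt (update v i a))) => //.
    exact: run_update.
  split=> //; apply: safe_CList => j' _; case: eqP => // _.
  exact: safe_CNth.
have args n (ts : 'I_n ->
  term tau k) : os = [seq OTerm (ts i) | i <- enum 'I_n] ->
    safe N (c_args n) (enc_seq [:: point v; enc_seq sts]).
  move=> tsE; apply: safe_CList => i _; apply: look.
  rewrite tsE size_map size_enum_ord; exact: ltn_ord.
have dom_range : unlist (run (CCall c_range [:: c_dom (CVar 0)])
    (enc_seq [:: point v;
      enc_seq sts])) = [seq enc_elt a | a <- enum (ex_struct e)].
  by rewrite -range_card -[RHS]enc_seqK -run_range.
(* Both quantifiers at once: the hypothesis on [b] and [z] says that the branches add no safety
   condition to that of the lookup. *)
have quant z c i : os = [:: OForm c] ->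
    forall b, (forall env,
      safe N (CIf (c_look 0 (c_update i) (CVar 3)) b z) env <->
       safe N (c_look 0 (c_update i) (CVar 3)) env) -> forall z',
       (forall env, safe N z' env) ->
    safe N (CFold (CCall c_range [:: c_dom (CVar 0)]) z'
       (CIf (c_look 0 (c_update i) (CVar 3)) b z)) (enc_seq [:: point v;
         enc_seq sts]).
  move=> cE b bz z' sz'; split=> //.
  - by split=> //; apply: (@safe_range N #|ex_struct e|).
  - by rewrite dom_range size_map -cardE.
  move=> s1 x s2; rewrite dom_range => E; apply/bz.
  have : x \in [seq enc_elt a | a <- enum (ex_struct e)].
    by rewrite E mem_cat mem_head orbT.
  by case/mapP=> a _ ->; apply: look_upd; rewrite cE.
case: o osE => [[R ts|p q|p q|p|i p|i p]|[i|f ts|p t u]] osE;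
  rewrite [head_symbol _]/=.
- split; first by split=> //=; [exact: args osE | split=> //; apply: safe_CNth].
  change (safe N c_mem (enc_seq [:: run (c_args (rel_ar R))
     (enc_seq [:: point v; enc_seq sts]); run (c_rel R (CVar 0))
     (enc_seq [:: point v; enc_seq sts])])).
  have [le_R le_a] := le_rel R.
  by rewrite (run_args osE) run_rel; apply: safe_mem; rewrite ?size_map -?cardE.
- by split; [|case: ifP => _]; rewrite ?osE //; apply: look; rewrite osE.
- by split; [|case: ifP => _]; rewrite ?osE //; apply: look; rewrite osE.
- by split; [|case: ifP => _]; rewrite ?osE //; apply: look; rewrite osE.
- apply: quant osE _ _ _ _ => // env; split=> [[]|] //.
  by move=> sl; split=> //; case: ifP.
- apply: quant osE _ _ _ _ => // env; split=> [[]|] //.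
  by move=> sl; split=> //; case: ifP.
- exact: safe_CNth.
- split; first by split=> //=; [exact: args osE | split=> //; apply: safe_CNth].
  change (safe N c_assoc (enc_seq [:: run (c_args (fun_ar f))
     (enc_seq [:: point v; enc_seq sts]); run (c_fun f (CVar 0))
     (enc_seq [:: point v; enc_seq sts])])).
  have [le_f le_a] := le_fun f.
  by rewrite (run_args osE) run_fun; apply: safe_assoc;
    rewrite // size_map -cardT.
- by split; [|case: ifP => _]; apply: look; rewrite osE.
Qed.

End Look.

(** * Assembling the state of a node *)

Fixpoint c_quote (x : sexp) : code :=
  if x is Cons a d then CCons (c_quote a) (c_quote d) else CAtom.

Lemma run_quote x env : run (c_quote x) env = x.
Proof. by elim: x => //= a -> d ->. Qed.

Lemma safe_quote N x env : safe N (c_quote x) env.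
Proof. by elim: x. Qed.

Opaque c_quote.

Definition c_free_bit (s : symbol) (i : 'I_k) : code :=
  if is_var s i then CTrue
  else if binds s i then CAtom
  else CFold (CVar 1) CAtom
         (CIf (CNth (val i) (CCar (CCdr (CVar 0)))) CTrue (CVar 1)).

Definition sort_sexp (s : symbol) : sexp := enc_seq (map sbool (arg_sorts s)).

(* The environment holds a node, the states of its children and the points; the
   new state is boxed, and [Atom] is returned on an ill-sorted node. *)
Definition c_apply (s : symbol) : code :=
  CIf (CEq (c_quote (sort_sexp s)) (CCall c_map_car [:: CVar 1]))
    (CCons (CCons (c_quote (sbool (out_sort s)))
              (CCons (CList [seq c_free_bit s i | i <- enum 'I_k])
                 (CFold (CVar 2) CAtom
                    (CCons (CCons (CVar 0)
                              (CCall (c_value s) [:: CVar 0; CVar 3]))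
                       (CVar 1)))))
       CAtom)
    CAtom.

Hypothesis point_pts : forall p, p \in pts ->
  exists e v, List.In e exs /\ p = @point r e v.

(** By [point_pts] every listed point stems from an example, so no table entry is left undetermined.
    This identifies the state found by completeness with the target state. *)
Lemma is_state_inj st1 st2 o : is_state st1 o -> is_state st2 o -> st1 = st2.
Proof.
move=> [f1 -> f1E] [f2 -> f2E]; congr (Cons _ (Cons _ (enc_seq _))).
apply/eq_in_map => p /point_pts [e [v [e_exs ->]]].
by rewrite f1E // f2E.
Qed.

Lemma run_free_bit s a sts os q i : are_states sts os ->
  run (c_free_bit s i) (enc_seq [:: a; enc_seq sts; q]) =
  sbool (is_var s i || ~~ binds s i && has (fun c => i \in free_vars c) os).
Proof.
rewrite /c_free_bit => H; case: is_var => //; case: binds => //=.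
rewrite enc_seqK; move: (Cons a _) => env;
  elim: H => //= st o {}sts {}os [f -> _] _ ->.
rewrite (@run_CNth _ _ [seq sbool (i \in free_vars o) | i <- enum 'I_k]) //.
rewrite (nth_map i) ?size_enum_ord //= nth_ord_enum is_cons_sbool.
by case: (i \in _).
Qed.

Lemma state_sorts sts os : are_states sts os ->
  map car sts = map sbool (map is_form os).
Proof. by elim=> //= st o {}sts {}os [f -> _] _ ->. Qed.

Lemma sbool_inj : injective sbool.
Proof. by case=> -[]. Qed.

Lemma sort_testP s a sts os q : are_states sts os ->
  is_cons (run (CEq (c_quote (sort_sexp s)) (CCall c_map_car [:: CVar 1]))
    (enc_seq [:: a; enc_seq sts; q])) = (map is_form os == arg_sorts s).
Proof.
move=> H; rewrite /= run_quote run_map_car (state_sorts H) is_cons_sbool.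
by rewrite (inj_eq enc_seq_inj) (inj_eq (inj_map sbool_inj)) eq_sym.
Qed.

Lemma run_apply a sts o : are_states sts (children o) ->
  exists2 st, is_state st o &
    run (c_apply (head_symbol o)) (enc_seq [:: a; enc_seq sts; enc_seq pts]) =
    Cons st Atom.
Proof.
move=> H; set s := head_symbol o; set env := enc_seq _.
(* The table function is the value code itself, which sees nothing but the encoded point and the
   children's states. *)
exists (Cons (sbool (is_form o)) (Cons (free_bits o) (table (fun p =>
  run (c_value s) (enc_seq [:: p; enc_seq sts]))))).
  eexists; [reflexivity | move=> e v e_exs].
  exact: (run_value v e_exs H).
rewrite /c_apply; set test := CEq _ _; set out := CCons _ _.
change ((if is_cons (run test env) then run out env else Atom) =
  Cons (Cons (sbool (is_form o)) (Cons (free_bits o) (table (fun p =>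
  run (c_value s) (enc_seq [:: p; enc_seq sts]))))) Atom).
rewrite (sort_testP _ _ _ H) children_sorts eqxx /out.
rewrite [LHS]/= run_quote is_formE enc_seqK foldr_enc_seq run_CList -map_comp.
congr (Cons (Cons _ (Cons (enc_seq _) _)) _); apply: eq_map => i.
by rewrite /= (run_free_bit _ _ _ _ H) -free_varsE.
Qed.

(** Such nodes do occur: [well_ranked] controls the number of children but not their sorts, and a
    nonterminal may contribute objects of both sorts. *)
Lemma run_apply_ill_sorted s a sts os : are_states sts os ->
  map is_form os != arg_sorts s ->
  run (c_apply s) (enc_seq [:: a; enc_seq sts; enc_seq pts]) = Atom.
Proof.
move=> H /negPf sF; rewrite /c_apply; set test := CEq _ _; set out := CCons _ _.
change ((if is_cons (run test (enc_seq [:: a; enc_seq sts; enc_seq pts]))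
  then run out (enc_seq [:: a; enc_seq sts; enc_seq pts]) else Atom) = Atom).
by rewrite (sort_testP _ _ _ H) sF.
Qed.

Lemma safe_apply N s a sts os : are_states sts os ->
  (forall e, List.In e exs -> example_le N e) ->
  size pts <= N -> size sts <= N -> sexp_size (sort_sexp s) <= N ->
  safe N (c_apply s) (enc_seq [:: a; enc_seq sts; enc_seq pts]).
Proof.
move=> H exs_le le_pts le_sts le_s; set env := enc_seq _.
split.
  split; [exact: safe_quote | | by rewrite run_quote].
  by split=> //; apply: safe_map_car.
(* Once the sort test succeeds, the children are those of an actual object, so the safety of its
   value code is available. *)
rewrite (sort_testP _ _ _ H); case: eqP => // /object_of_children[o [<- osE]].
split=> //; split; first exact: safe_quote.
split.
  apply: safe_CList => i _; rewrite /c_free_bit; case: is_var => //.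
  case: binds => //; split=> //; first by rewrite /= enc_seqK.
  move=> s1 x s2 _; split; last by case: ifP.
  exact: safe_CNth.
split=> //; first by rewrite /= enc_seqK.
rewrite /= enc_seqK => s1 p s2 ptsE; do !split=> //.
have [|e [v [e_exs ->]]] := @point_pts p.
  by rewrite ptsE mem_cat mem_head orbT.
by apply: safe_value => //; [rewrite -osE in H; exact: H | apply: exs_le].
Qed.

End Values.

(** * Evaluation of right-hand sides *)

Opaque c_quote c_apply c_value.

(** A table entry is [Cons (Cons B st) wit]; selection removes [B] and leaves the pair
    [Cons st wit], the format of evaluation results. *)
Definition c_select : code :=
  CFold (CVar 1) CAtom
    (CIf (CEq (CVar 2) (CCar (CCar (CVar 0))))
       (CCons (CCons (CCdr (CCar (CVar 0))) (CCdr (CVar 0))) (CVar 1))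
       (CVar 1)).

Definition select (B : sexp) (T : seq sexp) : seq sexp :=
  [seq Cons (cdr (car x)) (cdr x) | x <- T & B == car (car x)].

Lemma run_select B T :
  run c_select (enc_seq [:: B; enc_seq T]) = enc_seq (select B T).
Proof.
rewrite /= enc_seqK /select; elim: T => //= x T ->.
by rewrite is_cons_sbool; case: ifP.
Qed.

Lemma safe_select N B T : size T <= N -> sexp_size B <= N ->
  safe N c_select (enc_seq [:: B; enc_seq T]).
Proof.
move=> le_T le_B; split=> //=; rewrite ?size_unlist_enc // => s1 x s2 _.
by split=> //; case: ifP.
Qed.

Lemma size_select B T : size (select B T) <= size T.
Proof. by rewrite size_map size_filter count_size. Qed.

Opaque c_select.

Definition c_combos : code :=
  CFold (CVar 0) (CCons CAtom CAtom) (CCall c_prod [:: CVar 0; CVar 1]).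

Definition combos (rs : seq (seq sexp)) : seq sexp := foldr prods [:: Atom] rs.

Lemma run_combos rs :
  run c_combos (enc_seq [:: enc_seq (map enc_seq rs)]) = enc_seq (combos rs).
Proof. by rewrite /= enc_seqK; elim: rs => //= r rs ->; apply: run_prod. Qed.

Lemma mem_combos rs c : c \in combos rs ->
  exists2 l, c = enc_seq l & List.Forall2 (fun x (r : seq sexp) => x \in r) l
    rs.
Proof.
elim: rs c => [|r rs IHrs] c /=; first by rewrite inE => /eqP->; exists [::].
case/allpairsP=> -[x d] /= [xr /IHrs[l -> lrs] ->].
by exists (x :: l) => //; constructor.
Qed.

Lemma combos_mem rs l :
  List.Forall2 (fun x (r : seq sexp) => x \in r) l rs ->
    enc_seq l \in combos rs.
Proof.
elim=> //= x r {}l {}rs xr _ lrs.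
by apply/allpairsP; exists (x, enc_seq l).
Qed.

(** Under a product the exponents add up. With tree sizes as weights, this makes a bound
    [m.+1 ^ size] stable from the children to their parent. *)
Lemma size_combos (T : eqType) m (f : T -> seq sexp) (w : T -> nat) s :
  {in s, forall y, size (f y) <= m.+1 ^ w y} ->
  size (combos (map f s)) <= m.+1 ^ sumn (map w s).
Proof.
elim: s => //= y s IHs H; rewrite size_allpairs expnD leq_mul //.
  by apply: H; rewrite mem_head.
by apply: IHs => z zs; apply: H; rewrite inE zs orbT.
Qed.

Lemma safe_combos N rs :
  (forall s1 s2, rs = s1 ++ s2 -> size (combos s2) <= N) ->
  {in rs, forall r : seq sexp, size r <= N} -> size rs <= N ->
  safe N c_combos (enc_seq [:: enc_seq (map enc_seq rs)]).
Proof.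
move=> le_suffix le_r le_rs; split=> //=;
  first by rewrite size_unlist_enc size_map.
rewrite enc_seqK => s1 x s2 E; split; first by do !split.
have sE : drop (size s1).+1 (map enc_seq rs) = s2.
  by rewrite E -cat_rcons drop_size_cat ?size_rcons.
have rsE := cat_take_drop (size s1).+1 rs.
have accE : foldr (fun x acc => run c_prod (Cons x (Cons acc Atom)))
    (Cons Atom Atom) s2 = enc_seq (combos (drop (size s1).+1 rs)).
  by rewrite -run_combos /= enc_seqK map_drop sE.
rewrite accE.
have : x \in map enc_seq rs by rewrite E mem_cat mem_head orbT.
case/mapP=> r r_rs ->.
apply: (@safe_prod N r (combos (drop (size s1).+1 rs))); first exact: le_r.
exact: le_suffix (esym rsE).
Qed.

Opaque c_combos.

(** * Dispatch on the head symbol and combination of children *)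

Lemma enc_symbol_inj (tau : signature) (k : nat) :
  injective (@enc_symbol tau k).
Proof.
have inj (T : finType) (x y : T) : enc_elt x = enc_elt y -> x = y.
  exact: enc_elt_inj.
move=> [R|f| | | | |i|i|i] [R'|f'| | | | |i'|i'|i'] //= [].
- by move/inj->.
- by move/inj->.
all: by move/enc_nat_inj/val_inj->.
Qed.

Definition all_symbols (tau : signature) (k : nat) : seq (symbol tau k) :=
  [seq SRel R | R <- enum (relsym tau)] ++ [seq SFun f | f <- enum (funsym
    tau)] ++
  [:: SIte; SAnd; SOr; SNot] ++ [seq SAll i | i <- enum 'I_k] ++
  [seq SEx i | i <- enum 'I_k] ++ [seq SVar i | i <- enum 'I_k].

Lemma In_cat (T : Type) (x : T) s1 s2 :
  List.In x (s1 ++ s2) <-> List.In x s1 \/ List.In x s2.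
Proof. by elim: s1 => /= [|y s1 ->]; tauto. Qed.

Lemma In_all_symbols (tau : signature) (k : nat) (s : symbol tau k) :
  List.In s (all_symbols tau k).
Proof.
have In_map (T : finType) (f : T ->
  symbol tau k) x : List.In (f x) (map f (enum T)).
  apply: List.in_map; have := mem_enum T x.
  by elim: (enum T) => //= y l IH; rewrite !inE => /orP[/eqP->|/IH]; auto.
by case: s => *; rewrite !In_cat /=; auto 10.
Qed.

Section Algorithm.
Variables (tau : signature) (k : nat).

(* The environment holds a node, the states of its children and the points. *)
Definition c_dispatch : code :=
  foldr (fun s c => CIf (CEq (c_quote (@enc_symbol tau k s)) (CVar 0)) (c_apply
    s) c)
    CAtom (all_symbols tau k).

Lemma run_dispatch_symbol (s : symbol tau k) q :
  run c_dispatch (Cons (enc_symbol s) q) = run (c_apply s) (Cons (enc_symbol s)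
    q).
Proof.
rewrite /c_dispatch; elim: all_symbols (In_all_symbols s) => //= s' l IHl.
case=> [->|/IHl->]; rewrite run_quote is_cons_sbool ?eqxx //.
by case: eqP => // /enc_symbol_inj->.
Qed.

Lemma run_dispatch_other a q : (forall s : symbol tau k, a <> enc_symbol s) ->
  run c_dispatch (Cons a q) = Atom.
Proof.
move=> neq_a; rewrite /c_dispatch; elim: all_symbols => //= s l ->.
by rewrite run_quote is_cons_sbool; case: eqP => // E; case: (neq_a s).
Qed.

(** Evaluation is analysed on arbitrary S-expressions, whose nodes may carry heads that encode no
    symbol. *)
Lemma symbol_dec a : (exists s : symbol tau k, a = enc_symbol s) \/
  (forall s : symbol tau k, a <> enc_symbol s).
Proof.
have : (exists2 s : symbol tau k,
  List.In s (all_symbols tau k) & a = enc_symbol s) \/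
   (forall s : symbol tau k, List.In s (all_symbols tau k) ->
     a <> enc_symbol s).
  elim: all_symbols => /= [|s l [[s' sl ->]|IH]]; first by right.
    by left; exists s'; auto.
  case: (a =P enc_symbol s) => [->|ne]; first by left; exists s; auto.
  by right=> s' [<-|/IH].
case=> [[s _ ->]|H]; first by left; exists s.
by right=> s; apply: H; apply: In_all_symbols.
Qed.

Lemma safe_dispatch N a q :
  (forall s : symbol tau k, sexp_size (enc_symbol s) <= N) ->
  (forall s : symbol tau k, safe N (c_apply s) (Cons a q)) ->
  safe N c_dispatch (Cons a q).
Proof.
move=> le_s sa; rewrite /c_dispatch; elim: all_symbols => //= s l IHl.
rewrite run_quote; split; last by case: ifP.
by split=> //; exact: safe_quote.
Qed.

Opaque c_dispatch.

Definition c_combine : code :=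
  CFold (CVar 1) CAtom
    (CLet (CCons (CCall c_dispatch [:: CVar 2; CCall c_map_car [:: CVar 0];
      CVar 4])
             CEnv)
       (CIf (CVar 0)
          (CCons (CCons (CCar (CVar 0))
                    (CCons (CVar 3) (CCall c_map_cdr [:: CVar 1])))
             (CVar 2))
          (CVar 2))).

Variable pts : seq sexp.

Definition dispatch (a : sexp) (c : sexp) : sexp :=
  run c_dispatch (enc_seq [:: a; enc_seq (map car (unlist c)); enc_seq pts]).

(** The second component of a result is [enc_objectE] read from right to left: the node with the
    children's witnesses below it. *)
Definition combine (a : sexp) (cs : seq sexp) : seq sexp :=
  [seq Cons (car (dispatch a c)) (Cons a (enc_seq (map cdr (unlist c))))
  | c <- cs & is_cons (dispatch a c)].

Lemma run_combine a cs :
  run c_combine (enc_seq [:: a; enc_seq cs;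
    enc_seq pts]) = enc_seq (combine a cs).
Proof.
rewrite /= enc_seqK /combine; elim: cs => //= c cs ->.
have carE := run_map_car (unlist c); have cdrE := run_map_cdr (unlist c).
rewrite unlistK /= in carE cdrE.
by rewrite carE cdrE -/(dispatch a c); case: ifP.
Qed.

Lemma safe_combine N a cs :
  {in cs, forall c, size (unlist c) <= N /\
    safe N c_dispatch (enc_seq [:: a; enc_seq (map car (unlist c));
      enc_seq pts])} ->
  size cs <= N ->
  safe N c_combine (enc_seq [:: a; enc_seq cs; enc_seq pts]).
Proof.
move=> H le_cs; split=> //=; first by rewrite enc_seqK.
rewrite enc_seqK => s1 c s2 E.
have [|le_c sd] := H c; first by rewrite E mem_cat mem_head orbT.
have carE := run_map_car (unlist c); have cdrE := run_map_cdr (unlist c).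
have sc := @safe_map_car N (unlist c) le_c.
have sr := @safe_map_cdr N (unlist c) le_c.
rewrite unlistK /= in carE cdrE sc sr.
by rewrite carE; do !split=> //; case: ifP => // _; do !split.
Qed.

Opaque c_combine.

(* The environment holds the table of the derived objects, the points and a
   right-hand side; the result lists the pairs of a state and a witness. *)
Definition c_eval : code :=
  CTree (CVar 2)
    (CIf (CCar (CVar 0))
       (CCall c_combine [:: CCar (CVar 0); CCall c_combos [:: CVar 1]; CVar 3])
       (CCall c_select [:: CCdr (CVar 0); CVar 2])).

Definition evaluate (T : seq sexp) (y : sexp) : seq sexp :=
  unlist (run c_eval (enc_seq [:: enc_seq T; enc_seq pts; y])).

Lemma run_eval T y :
  run c_eval (enc_seq [:: enc_seq T; enc_seq pts; y]) = enc_seq (evaluate T y).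
Proof. by rewrite /evaluate unlistK. Qed.

(** The head tells the two kinds of nodes apart: the encoding of a symbol is always a pair, while a
    nonterminal is tagged with [Atom]. *)
Lemma evaluateE T y : evaluate T y =
  if is_cons (car y)
  then combine (car y) (combos [seq evaluate T z | z <- unlist (cdr y)])
  else select (cdr y) T.
Proof.
rewrite /evaluate [run _ _]/= tree_foldE.
set F := fun y rs => _.
rewrite {1}/F; case: ifP => _.
  have -> : [seq tree_fold F z | z <- unlist (cdr y)] =
     map enc_seq [seq evaluate T z | z <- unlist (cdr y)].
    by rewrite -map_comp; apply: eq_map => z /=; rewrite /evaluate unlistK.
  by rewrite (run_combos [seq evaluate T z | z <- unlist (cdr y)])
    (run_combine (car y) (combos _)) enc_seqK.
by rewrite (run_select (cdr y) T) enc_seqK.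
Qed.

End Algorithm.

(** * Derivations *)

Opaque c_dispatch c_combine.

Section Derivations.
Variables (tau : signature) (k : nat) (G : grammar tau k).

(** Big-step derivation: the children of a node derive independently of each other, whereas
    rewriting interleaves their steps. Soundness builds such derivations bottom-up and completeness
    is an induction on them. *)
Inductive yields : rtree tau k (nonterm G) -> object tau k -> Prop :=
| yields_nonterm B t o : List.In (B, t) (rules G) -> yields t o ->
    yields (Nonterm B) o
| yields_op ts o : yields_seq ts (children o) ->
  yields (Op (head_symbol o) ts) o
with yields_seq :
  seq (rtree tau k (nonterm G)) -> seq (object tau k) -> Prop :=
| yields_nil : yields_seq [::] [::]
| yields_cons t o ts os : yields t o -> yields_seq ts os ->
    yields_seq (t :: ts) (o :: os).

Scheme yields_mut := Minimality for yields Sort Prop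
with yields_seq_mut := Minimality for yields_seq Sort Prop.

Notation tree := (@object_tree tau k (nonterm G)).
Notation derives := (clos_refl_trans _ (@derives1 tau k G)).
Implicit Types (o : object tau k) (t u : rtree tau k (nonterm G)).

Lemma yields_tree o : yields (tree o) o.
Proof.
elim/object_children_ind: o => o IH; rewrite object_treeE; apply: yields_op.
by elim: IH => /= [|c cs yc _ IH]; constructor.
Qed.

Lemma yields_seq_context o t u l l' os :
  (forall o, yields u o -> yields t o) ->
  yields_seq (l ++ u :: l') os -> yields_seq (l ++ t :: l') os.
Proof.
move=> ut; elim: l os => [|x l IHl] os /= H; inversion H; subst.
  by constructor; [apply: ut|].
by constructor; [|apply: IHl].
Qed.

Lemma derives1_yields t u o : derives1 t u -> yields u o -> yields t o.
Proof.
move=> tu; elim: tu o => {t u} [B t Bt o yt | s l t u l' _ IH o yu].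
  exact: yields_nonterm Bt yt.
by inversion yu; subst; apply: yields_op; apply: yields_seq_context IH _.
Qed.

(** The steps are undone one at a time from the final tree, which yields its own object. *)
Lemma derives_yields t o : derives t (tree o) -> yields t o.
Proof.
suff gen u : clos_refl_trans_1n _ (@derives1 tau k G) t u -> yields u o ->
  yields t o.
  by move=> d; apply: gen (clos_rt_rt1n _ _ _ _ d) (yields_tree o).
elim=> // x y z xy _ IH /IH; exact: derives1_yields.
Qed.

(** Children are rewritten from left to right; the prefix [l] generalises over those already
    finished. *)
Lemma derives_op s ts us : List.Forall2 derives ts us ->
  derives (Op s ts) (Op s us).
Proof.
suff gen l : List.Forall2 derives ts us ->
  derives (Op s (l ++ ts)) (Op s (l ++ us)).
  exact: (gen [::]).
move=> H; elim: H l => [|t u {}ts {}us tu _ IH] l; first exact: rt_refl.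
apply: (@rt_trans _ _ _ (Op s (l ++ u :: ts))).
  elim: tu => [x y xy|x|x y z _ IHxy _ IHyz].
  - by apply: rt_step; apply: derives1_context.
  - exact: rt_refl.
  - exact: rt_trans IHxy IHyz.
by rewrite -!cat_rcons; apply: IH.
Qed.

Lemma yields_derives t o : yields t o -> derives t (tree o).
Proof.
move: t o; apply: (yields_mut (P0 :=
  fun ts os => List.Forall2 derives ts (map tree os)))
  => [B t o Bt _ IH | ts o _ IH | | t o ts os _ IHt _ IHts].
- by apply: rt_trans IH; apply: rt_step; constructor.
- by rewrite object_treeE; apply: derives_op.
- by constructor.
- by constructor.
Qed.

Lemma in_languageE (phi : formula tau k) :
  in_language G phi <-> yields (Nonterm (axiom G)) (OForm phi).
Proof. by split=> [/(@derives_yields _ (OForm phi))|/yields_derives]. Qed.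

End Derivations.

(** * Soundness and completeness of the evaluation of right-hand sides *)

Section Evaluation.
Variables (tau : signature) (k : nat) (r : nat).
Variables (exs : seq (example tau r)) (pts : seq sexp) (G : grammar tau k).
Hypothesis pts_point : forall e (v : assignment k (ex_struct e)),
  List.In e exs -> @point tau k r e v \in pts.
Hypothesis point_pts : forall p, p \in pts ->
  exists e (v : assignment k (ex_struct e)),
    List.In e exs /\ p = @point tau k r e v.

Notation is_state := (@is_state tau k r exs pts).
Notation are_states := (@are_states tau k r exs pts).
Notation evaluate := (@evaluate tau k pts).
Notation yields := (@yields tau k G).
Notation yields_seq := (@yields_seq tau k G).

Definition sound (T : seq sexp) : Prop := forall x, x \in T -> exists B st o,
  [/\ x = Cons (Cons (enc_elt B) st) (enc_object o), is_state st o &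
      yields (Nonterm B) o].

Lemma enc_rtree_op (t : rtree tau k (nonterm G)) y : y = enc_rtree t ->
  is_cons (car y) -> exists s ts, [/\ t = Op s ts, car y = enc_symbol s &
    unlist (cdr y) = [seq enc_rtree u | u <- ts]].
Proof.
by move=> ->; case: t => //= s ts _; exists s, ts; rewrite enc_seqK.
Qed.

Lemma enc_rtree_nonterm (t : rtree tau k (nonterm G)) y : y = enc_rtree t ->
  ~~ is_cons (car y) -> exists2 B, t = Nonterm B & cdr y = enc_elt B.
Proof. by move=> ->; case: t => [B|[]] //= _; exists B. Qed.

(** Derivability is conditional on [y] encoding a tree, because [safe] for tree folds ranges over
    all small S-expressions. The claim about states holds for every [y] and suffices for the running
    time. *)
Definition good_pair (y x : sexp) (o : object tau k) : Prop :=
  [/\ is_state (car x) o, x = Cons (car x) (enc_object o) &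
      forall t, y = enc_rtree t -> yields t o].

Lemma good_pairs T ys l :
  {in ys, forall y x, x \in evaluate T y -> exists o, good_pair y x o} ->
  List.Forall2 (fun x (q : seq sexp) => x \in q) l [seq evaluate T y | y <- ys]
    ->
  exists os, [/\ are_states (map car l) os,
    map cdr l = map (@enc_object _ _) os &
    forall ts, ys = [seq enc_rtree t | t <- ts] -> yields_seq ts os].
Proof.
elim: ys l => [|y ys IHys] l good H.
  by inversion H; exists [::]; split=> [||[|t ts]] //; constructor.
inversion H as [|x q l' qs xy Hl]; subst.
have [o [st xE yo]] := good _ (mem_head _ _) _ xy.
have [|os [sts lE yos]] := IHys l' _ Hl.
  by move=> z zs; apply: good; rewrite inE zs orbT.
exists (o :: os); split; first by constructor.
  by rewrite /= lE xE.
by case=> // t ts [tE tsE]; constructor; [apply: yo | apply: yos].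
Qed.

Lemma evaluate_sound T : sound T ->
  forall y x, x \in evaluate T y -> exists o, good_pair y x o.
Proof.
move=> T_sound y; have [m] := ubnP (sexp_size y);
  elim: m y => // m IHm y lt_m x.
rewrite evaluateE; case: ifPn => [y_op|y_nt].
  rewrite /combine => /mapP[c]; rewrite mem_filter => /andP[] disp_c.
  case/mem_combos=> l cE /good_pairs[].
    move=> z z_y u; apply: IHm; apply: leq_trans (sexp_size_unlist z_y) _.
    by case: (y) lt_m => //= ? ?; lia.
  move=> os [sts wits yos] xE.
  move: disp_c xE; rewrite /dispatch cE enc_seqK.
  case: (@symbol_dec tau k (car y)) => [[s sE]|no_s]; last first.
    by rewrite run_dispatch_other.
  rewrite sE run_dispatch_symbol.
  case: (eqVneq (map is_form os) (arg_sorts s)); last first.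
    by move=> ill; rewrite (run_apply_ill_sorted _ sts ill).
  case/object_of_children=> o [os_s osE]; rewrite -osE in sts wits yos.
  rewrite -os_s in sE *.
  have [st st_o ->] := run_apply pts_point (enc_symbol (head_symbol o)) sts.
  move=> _ ->; exists o; split=> //; first by rewrite enc_objectE -wits.
  move=> t /enc_rtree_op/(_ y_op)[s' [ts [-> s'E /yos ts_o]]].
  have -> : s' = head_symbol o; last exact: yields_op.
  by apply: enc_symbol_inj; rewrite -s'E.
case/mapP=> z; rewrite mem_filter => /andP[/eqP yz /T_sound[B [st [o [zE st_o
  yo]]]]] ->.
exists o; rewrite zE; split=> // t /enc_rtree_nonterm/(_ y_nt)[B' -> BE].
by have /enc_elt_inj-> : enc_elt B' = enc_elt B by rewrite -BE yz zE.
Qed.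

Lemma sumn_unlist x : sumn [seq sexp_size y | y <- unlist x] <= sexp_size x.
Proof. by elim: x => //= a _ d IH; rewrite -addnS leq_add2l ltnW. Qed.

Lemma size_cdr y : sexp_size (cdr y) <= sexp_size y.
Proof. by case: y => //= a d; rewrite -addSn leq_addl. Qed.

(** A nonterminal leaf offers at most [m] choices and a node multiplies those of its children. The
    base [m.+1] is positive, so the exponent may be enlarged to the full size of [y]. *)
Lemma size_evaluate T m y : size T <= m ->
  size (evaluate T y) <= m.+1 ^ sexp_size y.
Proof.
move=> le_T; have [n] := ubnP (sexp_size y); elim: n y => // n IHn y lt_n.
rewrite evaluateE; case: ifP => [y_op|_]; last first.
  apply: leq_trans (size_select _ _) _; apply: leq_trans le_T _.
  by rewrite (leq_trans (leqnSn _)) // -{1}[m.+1]expn1 leq_pexp2l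
    ?sexp_size_gt0.
rewrite size_map size_filter; apply: leq_trans (count_size _ _) _.
apply: (@leq_trans (m.+1 ^ sumn [seq sexp_size z | z <- unlist (cdr y)])).
  apply: size_combos => z z_y; apply: IHn;
    apply: leq_trans (sexp_size_unlist z_y) _.
  by apply: leq_trans (size_cdr y) _.
by rewrite leq_pexp2l // (leq_trans (sumn_unlist _)) ?size_cdr.
Qed.

(** Only the key has to be present, possibly with another witness, since the first witness of a key
    is never replaced. *)
Definition saturated (T : seq sexp) : Prop := forall B t st wit,
  List.In (B, t) (rules G) -> Cons st wit \in evaluate T (enc_rtree t) ->
  exists wit', Cons (Cons (enc_elt B) st) wit' \in T.

(** By induction on the derivation. The pair found has the state of [o], while [wit] need not encode
    [o]: at each nonterminal the table may substitute another entry with the same state. *)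
Lemma evaluate_complete T : saturated T -> forall t o, yields t o ->
  exists st wit, Cons st wit \in evaluate T (enc_rtree t) /\ is_state st o.
Proof.
move=> T_saturated; apply: (@yields_mut _ _ _ _ (fun ts os => exists2 l,
  List.Forall2 (fun x (q : seq sexp) => x \in q) l
    [seq evaluate T (enc_rtree t) | t <- ts] & are_states (map car l) os)).
- move=> B t o Bt _ [st [wit [x_in st_o]]].
  have [wit' x'_T] := T_saturated _ _ _ _ Bt x_in.
  exists st, wit'; split=> //; rewrite evaluateE /=; apply/mapP.
  by exists (Cons (Cons (enc_elt B) st) wit'); rewrite // mem_filter eqxx.
- move=> ts o _ [l l_in sts].
  have [st st_o stE] := run_apply pts_point (enc_symbol (head_symbol o)) sts.
  have dE : dispatch tau k pts (enc_symbol (head_symbol o)) (enc_seq l) = Cons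
    st Atom.
    by rewrite /dispatch enc_seqK run_dispatch_symbol.
  exists st, (Cons (enc_symbol (head_symbol o)) (enc_seq (map cdr l)));
    split=> //.
  rewrite evaluateE [car _]/=.
  have -> : is_cons (enc_symbol (head_symbol o)) by case: head_symbol.
  apply/mapP; exists (enc_seq l); last by rewrite dE enc_seqK.
  rewrite mem_filter dE /=; apply: combos_mem.
  by rewrite enc_seqK -map_comp.
- by exists [::]; constructor.
- move=> t o ts os _ [st [wit [x_in st_o]]] _ [l l_in sts].
  by exists (Cons st wit :: l); constructor.
Qed.

Lemma safe_evaluate N T m y :
  sound T -> size T <= m -> m.+1 ^ sexp_size y <= N -> sexp_size y <= N ->
  size pts <= N ->
  (forall e, List.In e exs -> @example_le tau k r N e) ->
  (forall s : symbol tau k, sexp_size (sort_sexp s) <= N) ->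
  (forall s : symbol tau k, sexp_size (enc_symbol s) <= N) ->
  safe N (c_eval tau k) (enc_seq [:: enc_seq T; enc_seq pts; y]).
Proof.
move=> T_sound le_T le_m le_y le_pts exs_le le_sort le_sym.
split=> // z; rewrite [sexp_size (run _ _)]/= => le_z.
set rs := [seq _ | _ <- _].
have rsE : rs = map enc_seq [seq evaluate T u | u <- unlist (cdr z)].
  by rewrite -map_comp; apply: eq_map => u; rewrite -[LHS]unlistK.
rewrite rsE {rs rsE}; split=> //; case: ifPn => [z_op|z_nt]; last first.
  split=> //; apply: (@safe_select N (cdr z) T).
    apply: leq_trans le_T _; apply: leq_trans (leqnSn _) _;
      apply: leq_trans le_m.
    by rewrite -{1}[m.+1]expn1 leq_pexp2l ?sexp_size_gt0.
  by apply: leq_trans (size_cdr z) _; apply: leq_trans le_z le_y.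
set ys := unlist (cdr z).
have le_suffix ys' : (exists ys'', ys = ys'' ++ ys') ->
    size (combos [seq evaluate T u | u <- ys']) <= N.
  case=> ys'' ysE; apply: leq_trans le_m.
  apply: leq_trans (size_combos (m := m) (w := sexp_size) _) _.
    by move=> u _; apply: size_evaluate.
  rewrite leq_pexp2l //; apply: leq_trans le_z; apply: leq_trans (size_cdr z).
  by apply: leq_trans (sumn_unlist (cdr z));
    rewrite -/ys ysE map_cat sumn_cat leq_addl.
have le_ys : size ys <= N.
  apply: leq_trans (size_unlist _) _; apply: leq_trans (size_cdr z) _.
  exact: leq_trans le_z le_y.
split.
  split=> //; split=> //; split=> //.
  apply: (@safe_combos N [seq evaluate T u | u <- ys]); rewrite ?size_map //.
    move=> s1 s2 E; have -> : s2 = [seq evaluate T u | u <- drop (size s1) ys].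
      by rewrite map_drop E drop_size_cat.
    by apply: le_suffix; exists (take (size s1) ys); rewrite cat_take_drop.
  move=> q /mapP[u u_ys ->]; apply: leq_trans (size_evaluate _ le_T) _.
  apply: leq_trans le_m; rewrite leq_pexp2l //; apply: leq_trans le_z.
  by apply: leq_trans (size_cdr z); apply: ltnW; apply: sexp_size_unlist.
change (safe N (c_combine tau k) (enc_seq [:: car z;
  run c_combos (enc_seq [:: enc_seq (map enc_seq [seq evaluate T u | u <-
    ys])]);
  enc_seq pts])).
rewrite run_combos; apply: safe_combine; last first.
  by apply: le_suffix; exists [::].
move=> c /mem_combos[l -> l_in]; rewrite enc_seqK.
have size_l : size l = size ys.
  by rewrite -[RHS](size_map (evaluate T)); elim: l_in => //= ? ? ? ? _ _ ->.
split; first by rewrite size_l.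
have [|os [sts _ _]] := good_pairs _ l_in.
  by move=> u _ x; apply: evaluate_sound.
apply: safe_dispatch => // s;
  apply: (safe_apply pts_point point_pts _ sts) => //.
by rewrite size_map size_l.
Qed.

End Evaluation.

(** * Saturation *)

Opaque c_eval.

Lemma is_cons_assoc key T : is_cons (assoc key T) = (key \in map car T).
Proof. by elim: T => //= x T IHT; rewrite inE; case: eqP. Qed.

Lemma assocP key T : (assoc key T = Atom /\ key \notin map car T) \/
  (exists2 x, x \in T & key = car x /\ assoc key T = Cons (cdr x) Atom).
Proof.
elim: T => [|x T IHT]; first by left.
rewrite /= inE; case: eqP => [->|_] /=; first by right; exists x;
  rewrite ?mem_head.
by case: IHT => [|[y yT yE]]; [left | right; exists y; rewrite // inE yT orbT].
Qed.

Definition insert (x : sexp) (T : seq sexp) : seq sexp :=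
  if car x \in map car T then T else x :: T.

Definition insert_all (es T : seq sexp) : seq sexp := foldr insert T es.

Lemma mem_insert_all es T x : x \in insert_all es T -> x \in es \/ x \in T.
Proof.
elim: es => [|y es IHes] /=; first by right.
have {}IHes : x \in insert_all es T -> x \in y :: es \/ x \in T.
  by case/IHes=> xe; [left; rewrite inE xe orbT | right].
rewrite /insert; case: ifP => _ //; rewrite inE => /orP[/eqP->|//].
by left; rewrite mem_head.
Qed.

Lemma uniq_insert_all es T : uniq (map car T) ->
  uniq (map car (insert_all es T)).
Proof. by move=> uT; elim: es => //= y es IHes; rewrite /insert;
  case: ifP => //= ->. Qed.

Lemma insert_all_keys es T x : x \in es -> car x \in map car (insert_all es T).
Proof.
elim: es => //= y es IHes; rewrite inE /insert => /orP[/eqP->|/IHes xT].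
  by case: ifP => //=; rewrite mem_head.
by case: ifP => //= _; rewrite inE xT orbT.
Qed.

(** Insertion only adds entries in front, so an unchanged size means an unchanged table. This is the
    progress measure of the saturation. *)
Lemma size_insert_all es T : size T <= size (insert_all es T) ?= iff
  (insert_all es T == T).
Proof.
suff [le_T eq_T] : size T <= size (insert_all es T) /\
   (size T = size (insert_all es T) -> insert_all es T = T).
  by split=> //; apply/eqP/eqP => [/eq_T|->].
elim: es => //= y es [le_T eq_T]; rewrite /insert; case: ifP => //= _.
by split=> [|E]; [apply: leqW | rewrite E ltnn in le_T].
Qed.

Definition candidate (B x : sexp) : sexp := Cons (Cons B (car x)) (cdr x).

Definition c_insert : code :=
  CFold (CVar 1) (CVar 2)
    (CIf (CCall c_assoc [:: CCons (CVar 2) (CCar (CVar 0)); CVar 1])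
       (CVar 1)
       (CCons (CCons (CCons (CVar 2) (CCar (CVar 0))) (CCdr (CVar 0))) (CVar
         1))).

Lemma run_insert B xs T : run c_insert (enc_seq [:: B; enc_seq xs; enc_seq T]) =
  enc_seq (insert_all (map (candidate B) xs) T).
Proof.
rewrite /= !enc_seqK; elim: xs => //= x xs ->.
rewrite (run_assoc (Cons B (car x)) (insert_all _ T)) is_cons_assoc /insert.
by case: ifP.
Qed.

Lemma safe_insert N B xs T :
  (forall x, x \in xs -> sexp_size (Cons B (car x)) <= N) -> size xs <= N ->
  (forall s1 s2, xs = s1 ++ s2 ->
    size (insert_all (map (candidate B) s2) T) <= N) ->
  safe N c_insert (enc_seq [:: B; enc_seq xs; enc_seq T]).
Proof.
move=> le_x le_xs le_T; split=> //=; rewrite enc_seqK // => s1 x s2 xsE.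
have := run_insert B s2 T; rewrite /= enc_seqK => ->.
split; last by case: ifP.
split=> //; apply: (@safe_assoc N (Cons B (car x)) (insert_all _ T)).
  by apply: (le_T (rcons s1 x)); rewrite cat_rcons.
by apply: le_x; rewrite xsE mem_cat mem_head orbT.
Qed.

Opaque c_insert.

(** Every rule is evaluated on the table [CVar 2] that the round started with, while insertion goes
    into the accumulator [CVar 1]; soundness and sizes of evaluations thus refer to one fixed
    table. *)
Definition c_round (tau : signature) (k : nat) : code :=
  CFold (CVar 1) (CVar 0)
    (CCall c_insert [:: CCar (CVar 0);
       CCall (c_eval tau k) [:: CVar 2; CVar 4; CCdr (CVar 0)]; CVar 1]).

Section Rounds.
Variables (tau : signature) (k : nat) (r : nat).
Variables (exs : seq (example tau r)) (pts : seq sexp) (G : grammar tau k).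
Hypothesis pts_point : forall e (v : assignment k (ex_struct e)),
  List.In e exs -> @point tau k r e v \in pts.
Hypothesis point_pts : forall p, p \in pts ->
  exists e (v : assignment k (ex_struct e)),
    List.In e exs /\ p = @point tau k r e v.

Notation is_state := (@is_state tau k r exs pts).
Notation evaluate := (@evaluate tau k pts).
Notation yields := (@yields tau k G).
Notation sound := (@sound tau k r exs pts G).
Notation saturated := (@saturated tau k pts G).

Variable keys : seq sexp.
Hypothesis keys_state : forall (B : nonterm G) st o,
  is_state st o -> Cons (enc_elt B) st \in keys.

Definition candidates (T rls : seq sexp) : seq sexp :=
  flatten [seq [seq candidate (car rl) x | x <- evaluate T (cdr rl)] | rl <-
    rls].

Definition round (rls T : seq sexp) : seq sexp :=
  insert_all (candidates T rls) T.

Lemma run_round T rls :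
  run (c_round tau k) (enc_seq [:: enc_seq T; enc_seq rls; enc_seq pts]) =
  enc_seq (round rls T).
Proof.
rewrite /= !enc_seqK /round /candidates.
elim: rls => //= rl rls ->; rewrite /insert_all foldr_cat.
move: (foldr insert T _) => acc.
rewrite -/(enc_seq [:: enc_seq T; enc_seq pts; cdr rl]) run_eval.
exact: run_insert.
Qed.

Definition enc_rules : seq sexp :=
  [seq Cons (enc_elt rl.1) (enc_rtree rl.2) | rl <- rules G].

Lemma In_mem (T1 : Type) (T2 : eqType) (f : T1 -> T2) s x :
  x \in map f s -> exists2 y, List.In y s & x = f y.
Proof.
elim: s => //= y s IHs; rewrite inE => /orP[/eqP->|/IHs[z zs ->]].
  by exists y; auto.
by exists z; auto.
Qed.

Lemma mem_In (T1 : Type) (T2 : eqType) (f : T1 -> T2) s x :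
  List.In x s -> f x \in map f s.
Proof. by elim: s => //= y s IHs [->|/IHs xs]; rewrite inE ?eqxx ?xs ?orbT. Qed.

Definition valid (T : seq sexp) : Prop := sound T /\ uniq (map car T).

Lemma valid_keys T : valid T -> {subset map car T <= keys}.
Proof. by move=> [T_sound _] _ /mapP[x /T_sound[B [st [o [-> st_o _]]]] ->];
  apply: keys_state st_o. Qed.

Lemma size_valid T : valid T -> size T <= size keys.
Proof.
by move=> vT; rewrite -(size_map car); apply: uniq_leq_size (valid_keys vT);
  case: vT.
Qed.

Lemma candidate_sound T rl x : sound T -> rl \in enc_rules ->
  x \in evaluate T (cdr rl) -> exists B st o,
  [/\ candidate (car rl) x = Cons (Cons (enc_elt B) st) (enc_object o),
    is_state st o &
      yields (Nonterm B) o].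
Proof.
move=> T_sound /In_mem[[B t] Bt ->] /(evaluate_sound pts_point T_sound)[o [st_o
  xE yo]].
exists B, (car x), o; split=> //; first by rewrite /candidate /= xE.
by apply: yields_nonterm Bt _; apply: yo.
Qed.

Lemma valid_insert_all T es : valid T ->
  (forall x, x \in es -> exists B st o,
  [/\ x = Cons (Cons (enc_elt B) st) (enc_object o), is_state st o &
      yields (Nonterm B) o]) -> valid (insert_all es T).
Proof.
move=> [T_sound uT] es_sound; split; last exact: uniq_insert_all.
by move=> x /mem_insert_all[/es_sound|/T_sound].
Qed.

Lemma candidates_sound T rls : sound T -> {subset rls <= enc_rules} ->
  forall x, x \in candidates T rls -> exists B st o,
  [/\ x = Cons (Cons (enc_elt B) st) (enc_object o), is_state st o &
      yields (Nonterm B) o].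
Proof.
move=> T_sound rls_G x /flattenP[_ /mapP[rl rl_in ->] /mapP[z zE ->]].
by apply: candidate_sound zE => //; apply: rls_G.
Qed.

Lemma valid_round T : valid T -> valid (round enc_rules T).
Proof.
move=> vT; apply: valid_insert_all => //; apply: (candidates_sound vT.1) => x.
by [].
Qed.

Lemma saturated_fixpoint T : round enc_rules T = T -> saturated T.
Proof.
move=> T_fix B t st wit Bt x_in.
have rl_in : Cons (enc_elt B) (enc_rtree t) \in enc_rules.
  exact: (mem_In (fun rl => Cons (enc_elt rl.1) (enc_rtree rl.2)) Bt).
have : Cons (Cons (enc_elt B) st) wit \in candidates T enc_rules.
  apply/flattenP; eexists; first by apply: map_f rl_in.
  by apply/mapP; exists (Cons st wit).
move/(insert_all_keys T); rewrite -/(round _ _) T_fix /= => /mapP[y yT yE].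
by exists (cdr y); rewrite yE; case: (y) yE yT.
Qed.

Definition saturation (n : nat) : seq sexp := iter n (round enc_rules) [::].

Lemma valid_saturation n : valid (saturation n).
Proof. by elim: n => [|n]; [split | apply: valid_round]. Qed.

(** Each round before stabilisation adds an entry, and a valid table has pairwise distinct keys, all
    from [keys]. Hence [size keys] rounds reach a fixed point. *)
Lemma saturated_saturation : saturated (saturation (size keys)).
Proof.
apply: saturated_fixpoint.
have grows n : n <= size (saturation n) \/ saturation n.+1 = saturation n.
  elim: n => [|n [le_n|fix_n]]; [by left | | right;
    rewrite [LHS]iterS -/(saturation n.+1) fix_n; exact: fix_n].
  have [le_T eq_T] := size_insert_all (candidates (saturation n) enc_rules)
    (saturation n).
  case: (eqVneq (saturation n.+1) (saturation n)) => [E|ne].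
    by right; rewrite [LHS]iterS -/(saturation n.+1) E.
  left; apply: leq_ltn_trans le_n _; rewrite ltn_neqAle [_ <= _]le_T andbT.
  by move: eq_T; rewrite /= => ->.
(* If every round so far has added an entry, the table already has at least as many entries as there
   are keys, and the next round has no room to grow. *)
case: (grows (size keys)) => // le_n.
have [le_T eq_T] := size_insert_all
  (candidates (saturation (size keys)) enc_rules) (saturation (size keys)).
apply/eqP; rewrite /round -eq_T eqn_leq le_T (leq_trans _ le_n) //.
exact: (size_valid (valid_saturation (size keys).+1)).
Qed.

Lemma safe_round N T : valid T ->
  (forall rl, rl \in enc_rules -> (size keys).+1 ^ sexp_size (cdr rl) <= N) ->
  (forall rl, rl \in enc_rules -> sexp_size (cdr rl) <= N) ->
  size enc_rules <= N -> size keys <= N ->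
  {in keys, forall key, sexp_size key <= N} ->
  size pts <= N ->
  (forall e, List.In e exs -> @example_le tau k r N e) ->
  (forall s : symbol tau k, sexp_size (sort_sexp s) <= N) ->
  (forall s : symbol tau k, sexp_size (enc_symbol s) <= N) ->
  safe N (c_round tau k) (enc_seq [:: enc_seq T; enc_seq enc_rules;
    enc_seq pts]).
Proof.
move=> vT le_exp le_rhs le_rls le_keys key_le le_pts exs_le le_sort le_sym.
have T_sound := vT.1.
split=> //=; rewrite enc_seqK // => s1 rl s2 rlsE.
have rl_in : rl \in enc_rules by rewrite rlsE mem_cat mem_head orbT.
have s2_in : {subset s2 <= enc_rules}.
  by move=> y ys; rewrite rlsE mem_cat inE ys !orbT.
have := run_round T s2; rewrite /= enc_seqK => ->.
(* A partially updated table is valid as well, so it never has more entries than there are keys. *)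
set acc := round s2 T.
have acc_v : valid acc.
  by apply: valid_insert_all => //; apply: candidates_sound.
rewrite -/(enc_seq [:: enc_seq T; enc_seq pts; cdr rl]) run_eval.
split.
  do 3 (split=> //).
  apply: (safe_evaluate pts_point point_pts T_sound (m := size keys)) => //.
  - exact: size_valid.
  - exact: le_exp.
  - exact: le_rhs.
have cand_sound x : x \in evaluate T (cdr rl) -> _ :=
  candidate_sound T_sound rl_in.
apply: safe_insert.
- move=> x /cand_sound[B [st [o [[-> -> _] st_o _]]]].
  by apply: key_le; apply: keys_state st_o.
- apply: leq_trans (size_evaluate _ _ _ _ (size_valid vT)) _.
  exact: le_exp.
move=> t1 t2 xsE; apply: leq_trans le_keys; apply: size_valid.
apply: valid_insert_all => // _ /mapP[x x_t2 ->].
by apply: cand_sound; rewrite xsE mem_cat x_t2 orbT.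
Qed.

End Rounds.

(** * Points and keys *)

Opaque c_round c_words words.

Lemma mem_range n x : reflect (exists2 j,
  j < n & x = enc_nat j) (x \in range n).
Proof.
apply: (iffP idP) => [/(nthP Atom)[j]|[j lt_j ->]].
  by rewrite size_range => lt_j <-; exists j; rewrite ?nth_range.
by rewrite -(nth_range lt_j) mem_nth ?size_range.
Qed.

Section Points.
Variables (k : nat).

Definition c_points : code :=
  CFold (CVar 0) CAtom
    (CFold (CCall (c_words k) [:: CCall c_range [:: CCar (CCar (CVar 0))]])
       (CVar 1) (CCons (CCons (CVar 2) (CVar 0)) (CVar 1))).

Definition dom_size (E : sexp) : nat := size (unlist (car (car E))).

Definition points (Es : seq sexp) : seq sexp :=
  flatten [seq [seq Cons E w | w <- words k (range (dom_size E))] | E <- Es].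

(** The range code is specified on genuine unary numerals, and [E] is here an arbitrary
    S-expression. *)
Definition good_example (E : sexp) : Prop := car (car E) = enc_nat (dom_size E).

Lemma run_points Es : (forall E, E \in Es -> good_example E) ->
  run c_points (enc_seq [:: enc_seq Es]) = enc_seq (points Es).
Proof.
move=> good; rewrite /= enc_seqK /points; elim: Es good => //= E Es IHEs good.
rewrite IHEs; last by move=> F FEs; apply: good; rewrite inE FEs orbT.
rewrite (good E) ?mem_head // run_range (run_words k) enc_seqK.
by rewrite /enc_seq foldr_cat; elim: (words _ _) => //= w ws ->.
Qed.

Lemma safe_points N Es : (forall E, E \in Es -> good_example E) ->
  (forall E, E \in Es -> dom_size E <= N /\ (dom_size E).+1 ^ k <= N) ->
  size Es <= N -> safe N c_points (enc_seq [:: enc_seq Es]).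
Proof.
move=> good le_N le_Es; split=> //=; rewrite enc_seqK // => s1 E s2 EsE.
have E_Es : E \in Es by rewrite EsE mem_cat mem_head orbT.
have [le_E le_k] := le_N E E_Es.
rewrite (good E) // run_range (run_words k) enc_seqK size_words size_range.
split=> //.
- split; last by apply: safe_words; rewrite size_range.
  by do 2 (split=> //); apply: safe_range.
- by apply: leq_trans le_k; apply: leq_expl.
Qed.

End Points.

Opaque c_points.

(** * Enumeration of the possible keys *)

Section Keys.
Implicit Types (pts : seq sexp) (p : sexp).
Variables (k : nat).

Definition bools : seq sexp := [:: Atom; Cons Atom Atom].

Lemma mem_bools b : sbool b \in bools.
Proof. by case: b. Qed.

Definition c_bools : code := c_quote (enc_seq bools).

Definition c_tables : code :=
  CFold (CVar 0) (CCons CAtom CAtom)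
    (CCall c_prod [:: CCall c_prod [:: CCons (CVar 0) CAtom;
       CCall c_range [:: CCons CAtom (CCar (CCar (CCar (CVar 0))))]]; CVar 1]).

(** A superset of the tables that occur: at each point any numeral up to and including the domain
    size. This covers the numbers of the elements and the truth values, which are the numerals 0 and
    1. *)
Definition tables (pts : seq sexp) : seq sexp :=
  foldr (fun p acc => prods (prods [:: p] (range (dom_size (car p)).+1)) acc)
    [:: Atom] pts.

Lemma run_tables pts : (forall p, p \in pts -> good_example (car p)) ->
  run c_tables (enc_seq [:: enc_seq pts]) = enc_seq (tables pts).
Proof.
move=> good; rewrite /= enc_seqK; elim: pts good => //= p pts IHpts good.
rewrite IHpts; last by move=> q q_pts; apply: good; rewrite inE q_pts orbT.
rewrite (good p) ?mem_head // (run_range (dom_size (car p)).+1).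
by rewrite (run_prod [:: p]) (run_prod (prods [:: p] _)).
Qed.

Lemma mem_tables pts f : {in pts, forall p,
  f p \in range (dom_size (car p)).+1} ->
  enc_seq [seq Cons p (f p) | p <- pts] \in tables pts.
Proof.
elim: pts => //= p pts IHpts f_in; apply/allpairsP.
exists (Cons p (f p), enc_seq [seq Cons q (f q) | q <- pts]); split=> //=.
  apply/allpairsP; exists (p, f p); split=> //=; first by rewrite inE.
  by apply: f_in; rewrite mem_head.
by apply: IHpts => q q_pts; apply: f_in; rewrite inE q_pts orbT.
Qed.

Lemma size_tables pts n : {in pts, forall p, dom_size (car p) < n} ->
  size (tables pts) <= n ^ size pts.
Proof.
elim: pts => //= p pts IHpts le_n.
rewrite !size_allpairs size_range mul1n expnS leq_mul ?le_n ?mem_head //.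
by apply: IHpts => q q_pts; apply: le_n; rewrite inE q_pts orbT.
Qed.

(** One entry of the list consists of [p], a numeral of size at most twice the domain size plus one,
    and two cells; hence the 3. *)
Lemma size_table pts (t : sexp) c :
  {in pts, forall p, sexp_size p + (dom_size (car p)).*2 + 3 <= c} ->
  t \in tables pts -> sexp_size t <= size pts * c + 1.
Proof.
elim: pts t => [|p pts IHpts] t /= le_c; first by rewrite inE => /eqP->.
case/allpairsP=> -[x u] /= [/allpairsP[[q y]] /= [q_p /mem_range[j lt_j yE]
  ->]].
move: q_p; rewrite inE => /eqP->.
move/IHpts => le_u ->; rewrite /= {}yE.
have {}le_u : sexp_size u <= size pts * c + 1.
  by apply: le_u => z z_pts; apply: le_c; rewrite inE z_pts orbT.
have -> : sexp_size (enc_nat j) = j.*2.+1 by elim: (j) => //= i ->; lia.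
have := le_c p; rewrite mem_head => /(_ isT); rewrite mulSn; lia.
Qed.

Lemma safe_tables N n pts : (forall p, p \in pts -> good_example (car p)) ->
  {in pts, forall p, dom_size (car p) < n} -> n <= N -> n ^ size pts <= N ->
    0 < N ->
  size pts <= N -> safe N c_tables (enc_seq [:: enc_seq pts]).
Proof.
move=> good lt_n le_n le_exp N0 le_pts; split=> //=;
  rewrite enc_seqK // => s1 p s2 E.
have p_pts : p \in pts by rewrite E mem_cat mem_head orbT.
have s2_pts : {subset s2 <= pts} by move=> q q_s2;
  rewrite E mem_cat inE q_s2 !orbT.
have := @run_tables s2; rewrite /= enc_seqK => -> //; last first.
  by move=> q /s2_pts; apply: good.
rewrite (good p) // (run_range (dom_size (car p)).+1) (run_prod [:: p]).
have lt_p : dom_size (car p) < N := leq_trans (lt_n p p_pts) le_n.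
split.
  do 2 (split=> //); last first.
    by apply: (@safe_prod N [:: p] (range _)); rewrite ?size_range.
  do 3 (split=> //).
  exact: (@safe_range N (dom_size (car p)).+1).
apply: (@safe_prod N (prods [:: p] _) (tables s2)).
  by rewrite size_allpairs size_range mul1n.
apply: leq_trans (@size_tables s2 n _) _.
  by move=> q /s2_pts; apply: lt_n.
apply: leq_trans le_exp; case: (posnP n) => [n0|n0].
  by have := lt_n p p_pts; rewrite n0.
by rewrite leq_pexp2l // E size_cat /=; lia.
Qed.

Opaque c_tables c_bools.

(* The environment holds the number of nonterminals and the points. *)
Definition c_keys : code :=
  CCall c_prod [:: CCall c_range [:: CVar 0];
    CCall c_prod [:: c_bools;
      CCall c_prod [:: CCall (c_words k) [:: c_bools];
        CCall c_tables [:: CVar 1]]]].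

Definition keys (n : nat) (pts : seq sexp) : seq sexp :=
  prods (range n) (prods bools (prods (words k bools) (tables pts))).

Lemma run_keys n pts : (forall p, p \in pts -> good_example (car p)) ->
  run c_keys (enc_seq [:: enc_nat n; enc_seq pts]) = enc_seq (keys n pts).
Proof.
move=> good; have bE env : run c_bools env = enc_seq bools by apply: run_quote.
rewrite /= bE run_range (run_words k) (run_tables good) (run_prod (words _ _)).
by rewrite (run_prod bools) (run_prod (range n)).
Qed.

Lemma size_keys n m pts : {in pts, forall p, dom_size (car p) < m} ->
  size (keys n pts) <= n * (2 * (2 ^ k * m ^ size pts)).
Proof.
move=> lt_m; rewrite !size_allpairs size_range size_words.
by rewrite !leq_mul ?size_tables.
Qed.

(** The condition on [3 ^ k] is that of [safe_words] for the two-letter alphabet of free-variable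
    bits. *)
Lemma safe_keys N n m pts : (forall p, p \in pts -> good_example (car p)) ->
  {in pts, forall p, dom_size (car p) < m} -> m <= N ->
  n * (2 * (2 ^ k * m ^ size pts)) <= N -> 0 < n -> 3 ^ k <= N -> 0 < m ->
  size pts <= N -> 1 < N -> safe N c_keys (enc_seq [:: enc_nat n; enc_seq pts]).
Proof.
move=> good lt_m le_m le_exp n0 le_3 m0 le_pts N1.
have bE env : run c_bools env = enc_seq bools by apply: run_quote.
have bS env : safe N c_bools env by apply: safe_quote.
have m_pts : 0 < m ^ size pts by rewrite expn_gt0 m0.
have k2 : 0 < 2 ^ k by rewrite expn_gt0.
have le_t := size_tables lt_m.
have le_n : n <= N by apply: leq_trans le_exp;
  rewrite leq_pmulr // !muln_gt0 k2 m_pts.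
have le_X : 2 * (2 ^ k * m ^ size pts) <= N.
  by apply: leq_trans le_exp; rewrite leq_pmull.
have le_k : 2 ^ k <= N.
  apply: leq_trans le_X; apply: leq_trans (leq_pmull _ (isT : 0 < 2)).
  by rewrite leq_pmulr.
have le_mp : m ^ size pts <= N.
  apply: leq_trans le_X; apply: leq_trans (leq_pmull _ (isT : 0 < 2)).
  by rewrite leq_pmull.
split; last first.
  rewrite /= bE run_range (run_words k) (run_tables good) (run_prod (words _
    _)).
  rewrite (run_prod bools); apply: safe_prod; rewrite ?size_range.
    exact: le_n.
  rewrite !size_allpairs size_words; apply: leq_trans le_X.
  by rewrite !leq_mul.
split; first by split=> //; apply: safe_range.
split=> //; split; last first.
  rewrite /= bE (run_words k) (run_tables good) (run_prod (words _ _)).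
  apply: safe_prod => //; rewrite !size_allpairs size_words;
    apply: leq_trans le_X.
  by apply: leq_trans (leq_pmull _ (isT : 0 < 2)); rewrite !leq_mul.
split=> //; split=> //; split; last first.
  rewrite /= bE (run_words k) (run_tables good).
  by apply: safe_prod; rewrite ?size_words //; apply: leq_trans le_mp.
split; first by split=> //; rewrite /= bE; apply: (@safe_words N k bools).
split=> //; split=> //; by apply: safe_tables lt_m le_m _ _ _ => //;
  apply: ltnW.
Qed.

End Keys.

Opaque c_keys.

(** * The state of the solutions *)

Opaque c_tables c_bools.

Section Coincidence.
Variables (tau : signature) (k : nat) (A : structure tau).
Implicit Types (phi : formula tau k) (t : term tau k) (v w : assignment k A).

(** The standard coincidence lemma. It turns the existential over assignments in [answer_set] into a
    statement about any assignment that extends the tuple. *)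
Lemma coincidence phi v w : {in fv phi, v =1 w} -> sat v phi = sat w phi.
Proof.
move: phi v w; apply: (@formula_term_ind tau k
  (fun phi => forall v w, {in fv phi, v =1 w} -> sat v phi = sat w phi)
  (fun t => forall v w, {in tfv t, v =1 w} -> value v t = value w t)) => /=.
- move=> R ts IH v w eq_vw.
  suff -> : [tuple value v (ts i) | i < rel_ar R] = [tuple value w (ts i) | i <
    rel_ar R] by [].
  apply/val_inj/eq_map => i; apply: IH => j j_i; apply: eq_vw.
  by apply/bigcupP; exists i.
- by move=> p IHp q IHq v w eq_vw; rewrite (IHp v w) 1?(IHq v w) // => i i_p;
    apply: eq_vw; rewrite inE i_p ?orbT.
- by move=> p IHp q IHq v w eq_vw; rewrite (IHp v w) 1?(IHq v w) // => i i_p;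
    apply: eq_vw; rewrite inE i_p ?orbT.
- by move=> p IHp v w /IHp->.
- move=> i p IHp v w eq_vw; apply: eq_existsb => a; apply: IHp => j j_p.
  by rewrite !ffunE; case: eqP => // /eqP ji; apply: eq_vw; rewrite !inE ji.
- move=> i p IHp v w eq_vw; apply: eq_forallb => a; apply: IHp => j j_p.
  by rewrite !ffunE; case: eqP => // /eqP ji; apply: eq_vw; rewrite !inE ji.
- by move=> i v w eq_vw; apply: eq_vw; rewrite inE.
- move=> f ts IH v w eq_vw; congr fun_int.
  apply/val_inj/eq_map => i; apply: IH => j j_i; apply: eq_vw.
  by apply/bigcupP; exists i.
- move=> p IHp t IHt u IHu v w eq_vw.
  by rewrite (IHp v w) 1?(IHt v w) 1?(IHu v w) // => i i_p;
    apply: eq_vw; rewrite !inE i_p ?orbT.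
Qed.

End Coincidence.

Section Target.
Variables (k : nat).

Definition prefix_bits (j : nat) : sexp :=
  enc_seq [seq sbool (i < j) | i : 'I_k <- enum 'I_k].

Definition c_target (j : nat) : code :=
  CCons CTrue (CCons (c_quote (prefix_bits j))
    (CFold (CVar 0) CAtom
       (CCons (CCons (CVar 0)
          (CCall c_mem [:: CList [seq CNth i (CCdr (CVar 0)) | i <- iota 0 j];
             CCdr (CCar (CVar 0))]))
          (CVar 1)))).

Definition point_prefix (j : nat) (p : sexp) : sexp :=
  enc_seq [seq nth Atom (unlist (cdr p)) i | i <- iota 0 j].

Definition expected (j : nat) (p : sexp) : sexp :=
  sbool (point_prefix j p \in unlist (cdr (car p))).

Definition target (j : nat) (pts : seq sexp) : sexp :=
  Cons (sbool true) (Cons (prefix_bits j) (enc_seq [seq Cons p (expected j p) |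
    p <- pts])).

Lemma run_prefix j p q :
  run (CList [seq CNth i (CCdr (CVar 0)) | i <- iota 0 j]) (Cons p q) =
    point_prefix j p.
Proof.
rewrite run_CList -map_comp; congr enc_seq; apply: eq_map => i /=.
by rewrite (@run_CNth _ _ (unlist (cdr p))) //= unlistK.
Qed.

Lemma run_expected j p q :
  run (CCall c_mem [:: CList [seq CNth i (CCdr (CVar 0)) | i <- iota 0 j];
             CCdr (CCar (CVar 0))]) (Cons p q) = expected j p.
Proof.
have := run_mem (point_prefix j p) (unlist (cdr (car p))).
by rewrite unlistK -/(expected j p) -(run_prefix j p q).
Qed.

Lemma run_target j pts : run (c_target j) (enc_seq [:: enc_seq pts]) = target j
  pts.
Proof.
rewrite /c_target; set c := CCall _ _; set env := enc_seq [:: _].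
have cE p q : run c (Cons p q) = expected j p := run_expected j p q.
change (Cons (sbool true) (Cons (run (c_quote (prefix_bits j)) env)
  (foldr (fun x acc => Cons (Cons x (run c (Cons x (Cons acc env)))) acc) Atom
    (unlist (enc_seq pts)))) = target j pts).
rewrite run_quote enc_seqK /target -foldr_enc_seq; congr (Cons _ (Cons _ _)).
by clearbody c; elim: pts env => //= p pts IHpts env; rewrite IHpts cE.
Qed.

Lemma safe_target N j pts : size pts <= N ->
  {in pts, forall p, size (unlist (cdr (car p))) <= N /\ sexp_size
    (point_prefix j p) <= N} ->
  safe N (c_target j) (enc_seq [:: enc_seq pts]).
Proof.
move=> le_pts le_p; split=> //; split; first exact: safe_quote.
split=> //; rewrite [run _ _]/= enc_seqK // => s1 p s2 ptsE.
have [|le_ans le_pre] := le_p p; first by rewrite ptsE mem_cat mem_head orbT.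
split=> //; split=> //; split.
  by split=> //; apply: safe_CList => i _; apply: safe_CNth.
have := safe_mem le_ans le_pre; rewrite unlistK.
set q := Cons _ (enc_seq [:: enc_seq pts]).
by rewrite -(run_prefix j p q).
Qed.

End Target.

Opaque c_target.

Section TargetState.
Variables (tau : signature) (k r : nat).
Variables (exs : seq (example tau r)) (pts : seq sexp).
Hypothesis pts_point : forall e (v : assignment k (ex_struct e)),
  List.In e exs -> @point tau k r e v \in pts.
Hypothesis point_pts : forall p, p \in pts ->
  exists e (v : assignment k (ex_struct e)),
    List.In e exs /\ p = @point tau k r e v.
Hypothesis le_rk : r <= k.

Definition restrict (A : structure tau) (v : assignment k A) : r.-tuple A :=
  [tuple v (widen_ord le_rk i) | i < r].

Lemma prefix_point (e : example tau r) (v : assignment k (ex_struct e)) :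
  point_prefix r (point v) = enc_tuple (restrict v).
Proof.
rewrite /point_prefix /enc_tuple [cdr _]/= /enc_asg enc_seqK; congr enc_seq.
transitivity [seq enc_elt (v (widen_ord le_rk i)) | i <- enum 'I_r]; last first.
  by rewrite map_comp.
rewrite -val_enum_ord -map_comp; apply: eq_map => i.
rewrite /comp -[val i]/(nat_of_ord (widen_ord le_rk i)).
by rewrite (nth_map (widen_ord le_rk i)) ?size_enum_ord ?nth_ord_enum ?ltn_ord.
Qed.

Lemma expected_point (e : example tau r) (v : assignment k (ex_struct e)) :
  expected r (point v) = sbool (restrict v \in ex_answers e).
Proof.
by rewrite /expected prefix_point /= enc_seqK (mem_map (@enc_tuple_inj _ _))
  mem_enum.
Qed.

Lemma answer_setP (e : example tau r) (phi : formula tau k) a :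
  reflect (exists2 v : assignment k (ex_struct e), restrict v = a & sat v phi)
    (a \in answer_set (ex_struct e) r phi).
Proof.
rewrite inE; apply: (iffP existsP) => [[v /andP[/forallP va sat_v]]|[v va
  sat_v]].
  exists v => //; apply: eq_from_tnth => i; rewrite tnth_mktuple.
  have /implyP/(_ (ltn_ord i))/eqP -> := va (widen_ord le_rk i).
  by rewrite [RHS](tnth_nth (v (widen_ord le_rk i))).
exists v; rewrite sat_v andbT; apply/forallP => i; apply/implyP => lt_i.
rewrite -va -(tnth_nth _ _ (Ordinal lt_i)) tnth_mktuple.
by apply/eqP; congr (v _); apply: val_inj.
Qed.

Lemma restrict_surj (A : structure tau) (a : r.-tuple A) :
  exists v : assignment k A, restrict v = a.
Proof.
have /card_gt0P[x0 _] := dom_gt0 A.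
exists [ffun i => nth x0 a (val i)]; apply: eq_from_tnth => i.
by rewrite tnth_mktuple ffunE -tnth_nth.
Qed.

(** From left to right, every tuple must extend to an assignment, which nonempty domains guarantee.
    From right to left, coincidence makes the value at a point depend on the first [r] variables
    only. *)
Lemma is_state_target (phi : formula tau k) :
  is_state exs pts (target k r pts) (OForm phi) <->
  fv phi = [set i : 'I_k | i < r] /\
  (forall e, List.In e exs -> answer_set (ex_struct e) r phi = ex_answers e).
Proof.
split=> [[f [bitsE tabE fE]]|[fvE ansE]].
  split.
    apply/setP=> i; rewrite inE; move/enc_seq_inj/eq_in_map: bitsE => /(_ i).
    by rewrite mem_enum => /(_ isT)/sbool_inj/esym.
  move=> e e_exs.
  have satE (v : assignment k (ex_struct e)) : sat v phi = (restrict v \in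
    ex_answers e).
    apply: sbool_inj; rewrite -expected_point -[LHS](fE e v e_exs).
    move/enc_seq_inj/eq_in_map: tabE => /(_ _ (pts_point v e_exs)).
    by case.
  apply/setP=> a; apply/answer_setP/idP => [[v <-]|a_in]; first by rewrite satE.
  by have [v va] := restrict_surj a; exists v => //; rewrite satE va.
exists (expected r) => [|e v e_exs].
  congr (Cons _ (Cons (enc_seq _) _)); apply: eq_map => i.
  by rewrite /= fvE inE.
rewrite expected_point /= -(ansE e e_exs); congr sbool.
apply/answer_setP/idP => [[w wv sat_w]|]; last by exists v.
rewrite (@coincidence _ _ _ _ _ w) // => i; rewrite fvE inE => lt_i.
have := congr1 (fun a => tnth a (Ordinal lt_i)) wv; rewrite !tnth_mktuple.
suff -> : widen_ord le_rk (Ordinal lt_i) = i by [].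
exact: val_inj.
Qed.

End TargetState.

(** * The algorithm *)

Section Program.
Variables (tau : signature) (k : nat).

(** The encoded instance is itself the environment. With the points pushed, positions 1 to 4 are the
    arity, the examples, the number of nonterminals and the axiom, and the remaining tail is the
    list of rules; under the two variables of the fold that tail is [iter 7 CCdr CEnv]. The list of
    keys is the clock of the saturation. *)
Definition c_solve (j : nat) : code :=
  CLet (CCons (CCall (c_points k) [:: CVar 1]) CEnv)
    (CCall c_assoc [:: CCons (CVar 4) (CCall (c_target k j) [:: CVar 0]);
       CFold (CCall (c_keys k) [:: CVar 3; CVar 0]) CAtom
         (CCall (c_round tau k) [:: CVar 1; iter 7 CCdr CEnv; CVar 2])]).

(** The target code depends on the arity, which is part of the input. An arity above [k] admits no
    solution, so one copy of the solver per arity up to [k] is enough. *)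
Definition c_main : code :=
  foldr (fun j c => CIf (CEq (c_quote (enc_nat j)) (CVar 0)) (c_solve j) c)
    CAtom (iota 0 k.+1).

Lemma run_main j q : run c_main (Cons (enc_nat j) q) =
  if j <= k then run (c_solve j) (Cons (enc_nat j) q) else Atom.
Proof.
have -> : (j <= k) = (j \in iota 0 k.+1) by rewrite mem_iota.
rewrite /c_main; elim: (iota 0 k.+1) => // i s IHs.
change ((if is_cons (sbool (run (c_quote (enc_nat i)) (Cons (enc_nat j) q) ==
  enc_nat j))
   then run (c_solve i) (Cons (enc_nat j) q) else
   run (foldr (fun j c => CIf (CEq (c_quote (enc_nat j)) (CVar 0)) (c_solve j)
     c)
    CAtom s) (Cons (enc_nat j) q)) =
   if j \in i :: s then run (c_solve j) (Cons (enc_nat j) q) else Atom).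
rewrite IHs run_quote is_cons_sbool (inj_eq enc_nat_inj) inE eq_sym.
by case: eqP => [->|].
Qed.

Lemma size_enc_nat j : sexp_size (enc_nat j) = j.*2.+1.
Proof. by elim: j => //= j ->; rewrite doubleS. Qed.

Lemma safe_main N j q : k.*2 < N ->
  (j <= k -> safe N (c_solve j) (Cons (enc_nat j) q)) ->
  safe N c_main (Cons (enc_nat j) q).
Proof.
move=> le_N; rewrite -ltnS -[j < _]/(0 <= j < 0 + k.+1) -mem_iota.
have : all (fun i => i <= k) (iota 0 k.+1).
  by apply/allP => i; rewrite mem_iota.
rewrite /c_main; elim: (iota 0 k.+1) => // i s IHs /andP[le_i le_s] sj.
split.
  split=> //; first exact: safe_quote.
  by rewrite run_quote size_enc_nat; apply: leq_trans le_N;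
    rewrite ltnS leq_double.
change (if is_cons (sbool (run (c_quote (enc_nat i)) (Cons (enc_nat j) q) ==
  enc_nat j))
   then safe N (c_solve i) (Cons (enc_nat j) q) else
   safe N (foldr (fun j c => CIf (CEq (c_quote (enc_nat j)) (CVar 0)) (c_solve
     j) c)
    CAtom s) (Cons (enc_nat j) q)).
rewrite run_quote is_cons_sbool (inj_eq enc_nat_inj).
case: eqP => [ij|_]; first by rewrite ij; apply: sj; rewrite inE ij eqxx.
by apply: IHs => // js; apply: sj; rewrite inE js orbT.
Qed.

Variable I : instance tau k.
Notation r := (arity I).
Notation exs := (examples I).
Notation G := (inst_grammar I).
Notation Es := [seq enc_example e | e <- exs].
Notation pts := (points k Es).
Notation ks := (keys k #|nonterm G| pts).
Notation T := (saturation pts G (size ks)).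

Lemma enc_exampleE (e : example tau r) :
  good_example (enc_example e) /\ dom_size (enc_example e) = #|ex_struct e|.
Proof. by rewrite /good_example /dom_size /= unlist_enc_nat size_nseq. Qed.

Lemma good_examples E : E \in Es -> good_example E.
Proof. by case/In_mem=> e _ ->; case: (enc_exampleE e). Qed.

Lemma pts_point (e : example tau r) (v : assignment k (ex_struct e)) :
  List.In e exs -> @point tau k r e v \in pts.
Proof.
move=> e_exs; apply/flattenP; eexists.
  by apply: map_f; apply: (mem_In (@enc_example tau r) e_exs).
apply/mapP; exists (enc_asg v) => //; rewrite (enc_exampleE e).2 range_card.
apply/mem_words; exists [seq enc_elt (v i) | i <- enum 'I_k] => //.
split; first by rewrite size_map size_enum_ord.
by move=> _ /mapP[i _ ->]; apply: map_f; rewrite mem_enum.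
Qed.

(** Every word of length [k] over the encoded domain comes from an assignment, whose values are
    recovered by choice. *)
Lemma point_pts p : p \in pts ->
  exists (e : example tau r) (v : assignment k (ex_struct e)),
    List.In e exs /\ p = point v.
Proof.
case/flattenP=> _ /mapP[_ /In_mem[e e_exs ->] ->] /mapP[w w_in ->].
move: w_in; rewrite (enc_exampleE e).2 range_card => /mem_words[s ->
  [size_s s_in]].
have elt (i : 'I_k) : exists a, enc_elt (a : ex_struct e) == nth Atom s i.
  have /s_in/mapP[a _ ->] : nth Atom s i \in s by rewrite mem_nth ?size_s.
  by exists a.
exists e, [ffun i => xchoose (elt i)]; split=> //; congr (Cons _ (enc_seq _)).
apply: (@eq_from_nth _ Atom); first by rewrite size_map size_enum_ord.
move=> i; rewrite size_s => lt_i.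
rewrite -[i]/(nat_of_ord (Ordinal lt_i)) (nth_map (Ordinal lt_i))
  ?size_enum_ord //.
by rewrite nth_ord_enum ffunE (eqP (xchooseP (elt _))).
Qed.

Lemma good_pts p : p \in pts -> good_example (car p).
Proof. by case/point_pts=> e [v [_ ->]]; case: (enc_exampleE e). Qed.

(** A nonempty domain puts the numeral 1, that is the truth value true, into the range that also
    lists the elements. *)
Lemma eval_object_range (e : example tau r) (v : assignment k (ex_struct e)) (o
  : object tau k) :
  eval_object v o \in range #|ex_struct e|.+1.
Proof.
apply/mem_range; case: o => [phi|t] /=.
  by exists (sat v phi); [rewrite ltnS; apply: leq_trans (dom_gt0 _);
    case: sat | case: sat].
by exists (enum_rank (value v t)) => //; apply: ltnW; rewrite ltnS.
Qed.

Lemma keys_state (B : nonterm G) st o :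
  @is_state tau k r exs pts st o -> Cons (enc_elt B) st \in ks.
Proof.
case=> f -> fE; apply/allpairsP.
exists (enc_elt B, Cons (sbool (is_form o)) (Cons (free_bits o) (table pts f))).
split=> //=; first by apply/mem_range; exists (enum_rank B).
apply/allpairsP; exists (sbool (is_form o), Cons (free_bits o) (table pts f)).
split=> //=; first exact: mem_bools.
apply/allpairsP; exists (free_bits o, table pts f); split=> //=.
  apply/mem_words; exists [seq sbool (i \in free_vars o) | i <- enum 'I_k] =>
    //.
  split; first by rewrite size_map size_enum_ord.
  by move=> _ /mapP[i _ ->]; apply: mem_bools.
apply: mem_tables => p /point_pts[e [v [e_exs ->]]].
by rewrite fE // (enc_exampleE e).2; apply: eval_object_range.
Qed.

Lemma run_saturation (s : seq sexp) :
  foldr (fun _ acc => run (c_round tau k)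
     (enc_seq [:: acc; enc_seq (enc_rules G); enc_seq pts])) Atom s =
  enc_seq (saturation pts G (size s)).
Proof. by elim: s => // x s IHs; rewrite [LHS]/= IHs run_round. Qed.

Lemma run_solve : run (c_solve r) (enc_instance I) =
  assoc (Cons (enc_elt (axiom G)) (target k r pts)) T.
Proof.
pose env := Cons (run (c_points k) (enc_seq [:: enc_seq Es])) (enc_instance I).
change (run c_assoc (enc_seq [:: Cons (enc_elt (axiom G))
   (run (c_target k r) (enc_seq [:: run (c_points k) (enc_seq [:: enc_seq
     Es])]));
   foldr (fun x acc => run (c_round tau k) (enc_seq [:: acc;
     enc_seq (enc_rules G);
      run (c_points k) (enc_seq [:: enc_seq Es])])) Atom
      (unlist (run (c_keys k) (enc_seq [:: enc_nat #|nonterm G|;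
        run (c_points k) (enc_seq [:: enc_seq Es])])))]) =
   assoc (Cons (enc_elt (axiom G)) (target k r pts)) T).
rewrite (run_points k good_examples) run_target (run_keys k _ good_pts)
  enc_seqK.
rewrite run_saturation; exact: run_assoc.
Qed.

Lemma solve_correct : r <= k -> exists2 o : option (formula tau k),
  run (c_solve r) (enc_instance I) = enc_output o & correct_output I o.
Proof.
move=> le_rk; rewrite run_solve.
have [T_sound _] := valid_saturation G pts_point (size ks).
have T_saturated : saturated pts G T :=
  saturated_saturation pts_point keys_state.
case: (assocP (Cons (enc_elt (axiom G)) (target k r pts)) T) => [[-> no_key]|].
  exists None => // phi [/in_languageE phi_G _ fvE ansE].
  (* A solution would have the target state and would be derivable from the axiom, so completeness
     would put its key into the table. *)
  have /(is_state_target pts_point le_rk) tgt := conj fvE ansE.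
  have [st [wit [x_in st_o]]] := evaluate_complete pts_point T_saturated phi_G.
  case/negP: no_key; rewrite (is_state_inj point_pts tgt st_o).
  move: x_in; rewrite evaluateE => /mapP[y];
    rewrite mem_filter => /andP[/eqP /= BE yT].
  case=> stE _; apply/mapP; exists y => //.
  by have [B [st' [o [yE _ _]]]] := T_sound y yT; rewrite BE stE yE.
case=> x /T_sound[B [st [o [-> st_o yo]]]] [/= [/enc_elt_inj BE stE] ->].
rewrite -stE in st_o; rewrite -BE in yo.
(* The sort bit of the target rules out terms. *)
case: o yo st_o => [phi|t] yo st_o; last by case: st_o.
exists (Some phi) => //.
have [fvE ansE] := (is_state_target pts_point le_rk phi).1 st_o.
by split=> //; apply/in_languageE.
Qed.

Lemma main_correct : exists2 o : option (formula tau k),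
  run c_main (enc_instance I) = enc_output o & correct_output I o.
Proof.
rewrite [run _ _]run_main; case: leqP => [/solve_correct //|lt_kr].
by exists None => // phi [_ le_rk]; rewrite leqNgt lt_kr in le_rk.
Qed.

(** The target may be the state of no object at all, so [keys_state] does not apply. Membership is
    wanted for the size bound on the key that the final search compares. *)
Lemma target_key : r <= k -> Cons (enc_elt (axiom G)) (target k r pts) \in ks.
Proof.
move=> le_rk; apply/allpairsP; exists (enc_elt (axiom G), target k r pts).
split=> //=; first by apply/mem_range; exists (enum_rank (axiom G)).
set tab := enc_seq [seq Cons p (expected r p) | p <- pts].
apply/allpairsP; exists (sbool true, Cons (prefix_bits k r) tab).
split=> //=; apply/allpairsP; exists (prefix_bits k r, tab); split=> //=.
  apply/mem_words; exists [seq sbool (i < r) | i : 'I_k <- enum 'I_k] => //.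
  split; first by rewrite size_map size_enum_ord.
  by move=> _ /mapP[i _ ->]; apply: mem_bools.
apply: mem_tables => p /point_pts[e [v [e_exs ->]]].
rewrite (enc_exampleE e).2 (expected_point le_rk).
apply/mem_range; set b := _ \in _; exists b; last by case: b.
by rewrite ltnS; apply: leq_trans (dom_gt0 _); case: b.
Qed.

Lemma safe_solve N m : r <= k ->
  (forall e, List.In e exs -> @example_le tau k r N e) ->
  (forall s : symbol tau k, sexp_size (sort_sexp s) <= N) ->
  (forall s : symbol tau k, sexp_size (enc_symbol s) <= N) ->
  (forall e, List.In e exs -> #|ex_struct e| < m) ->
  (forall e, List.In e exs -> #|ex_answers e| <= N) ->
  (forall e (a : r.-tuple (ex_struct e)), List.In e exs ->
    sexp_size (enc_tuple a) <= N) ->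
  m <= N -> 0 < m -> m ^ k <= N -> 3 ^ k <= N -> 1 < N ->
  size exs <= N -> size pts <= N ->
  #|nonterm G| * (2 * (2 ^ k * m ^ size pts)) <= N ->
  {in ks, forall key, sexp_size key <= N} ->
  (forall rl, rl \in enc_rules G -> (size ks).+1 ^ sexp_size (cdr rl) <= N) ->
  (forall rl, rl \in enc_rules G -> sexp_size (cdr rl) <= N) ->
  size (enc_rules G) <= N ->
  safe N (c_solve r) (enc_instance I).
Proof.
move=> le_rk exs_le le_sort le_sym dom_lt le_ans le_tup le_m m0 le_mk le_3 N1
  le_exs le_pts le_exp key_le rhs_exp rhs_le le_rls.
have dom_pts : {in pts, forall p, dom_size (car p) < m}.
  move=> p /point_pts[e [v [e_exs ->]]]; rewrite (enc_exampleE e).2;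
    exact: dom_lt.
have le_ks : size ks <= N by apply: leq_trans (size_keys _ _ dom_pts) le_exp.
have ptsE := run_points k good_examples.
have n0 : 0 < #|nonterm G| by apply/card_gt0P; exists (axiom G).
split.
  split=> //; split=> //; apply: safe_points; rewrite ?size_map //.
    exact: good_examples.
  move=> _ /In_mem[e e_exs ->]; rewrite (enc_exampleE e).2.
  have lt_e := dom_lt e e_exs; split; first by apply: ltnW (leq_trans lt_e _).
  by apply: leq_trans le_mk; apply: leq_expl.
change (safe N (CCall c_assoc [:: CCons (CVar 4) (CCall (c_target k r) [:: CVar
  0]);
       CFold (CCall (c_keys k) [:: CVar 3; CVar 0]) CAtom
         (CCall (c_round tau k) [:: CVar 1; iter 7 CCdr CEnv; CVar 2])])
  (Cons (run (c_points k) (enc_seq [:: enc_seq Es])) (enc_instance I))).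
rewrite ptsE; split; last first.
  change (safe N c_assoc (enc_seq [:: Cons (enc_elt (axiom G))
     (run (c_target k r) (enc_seq [:: enc_seq pts]));
     foldr (fun _ acc => run (c_round tau k)
       (enc_seq [:: acc; enc_seq (enc_rules G); enc_seq pts])) Atom
       (unlist (run (c_keys k) (enc_seq [:: enc_nat #|nonterm G|;
         enc_seq pts])))])).
  rewrite run_saturation run_target; apply: safe_assoc; last first.
    by apply: key_le; apply: target_key.
  apply: leq_trans le_ks.
  exact: (size_valid keys_state (valid_saturation G pts_point _)).
split.
  split=> //; split=> //;
    apply: safe_target => // p /point_pts[e [v [e_exs ->]]].
  rewrite (prefix_point le_rk); split; last exact: le_tup.
  by rewrite enc_seqK size_map -cardE; apply: le_ans.
split=> //; split=> //.
- by split=> //; apply: safe_keys good_pts dom_pts _ _ _ _ _ _ _.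
- by rewrite [run _ _](run_keys k _ good_pts) enc_seqK.
move=> s1 x s2 _.
change (safe N (CCall (c_round tau k) [:: CVar 1; iter 7 CCdr CEnv; CVar 2])
  (Cons x (Cons (foldr (fun _ acc => run (c_round tau k)
       (enc_seq [:: acc; enc_seq (enc_rules G); enc_seq pts])) Atom s2)
   (Cons (enc_seq pts) (enc_instance I))))).
rewrite run_saturation; split=> //.
exact: (safe_round pts_point point_pts keys_state (valid_saturation G pts_point
  _)).
Qed.

End Program.

(** * Running time *)

Opaque c_solve.

Lemma size_enc_seq (s : seq sexp) : size s < sexp_size (enc_seq s).
Proof. by elim: s => //= x s IHs; rewrite ltnS (leq_trans IHs) ?leq_addl. Qed.

Lemma size_car y : sexp_size (car y) <= sexp_size y.
Proof. by case: y => //= a d; rewrite -addnS leq_addr. Qed.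

Lemma enc_seq_mem s x : x \in s -> sexp_size x < sexp_size (enc_seq s).
Proof. by move=> xs; apply: sexp_size_unlist; rewrite enc_seqK. Qed.

Lemma enc_seq_le c s : {in s, forall x, sexp_size x <= c} ->
  sexp_size (enc_seq s) <= size s * c.+1 + 1.
Proof.
elim: s => //= x s IHs le_c; rewrite mulSn.
have := le_c x (mem_head _ _).
have /IHs : {in s, forall x, sexp_size x <= c}.
  by move=> y ys; apply: le_c; rewrite inE ys orbT.
lia.
Qed.

Lemma enc_tuple_le (T : finType) n (a : n.-tuple T) c : #|T| < c ->
  sexp_size (enc_tuple a) <= n * c.*2 + 1.
Proof.
move=> lt_c; rewrite -{2}(size_tuple a) -(size_map (@enc_elt T)).
have le_elt : {in [seq enc_elt x | x <- a], forall x, sexp_size x <= c.*2.-1}.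
  move=> _ /mapP[x _ ->]; rewrite /enc_elt size_enc_nat.
  by have := leq_trans (ltn_ord (enum_rank x)) (ltnW lt_c); lia.
apply: leq_trans (enc_seq_le le_elt) _; rewrite leq_add2r leq_mul2l; lia.
Qed.

(** * Bounds in terms of the size of the encoded instance *)

Section Bounds.
Variables (tau : signature) (k : nat).

(** A constant of the fixed alphabet; a sum over all symbols dominates each of them. *)
Definition symbol_bound : nat :=
  sumn [seq sexp_size (sort_sexp s) + sexp_size (enc_symbol s)
       | s <- all_symbols tau k].

Lemma symbol_boundP (s : symbol tau k) :
  sexp_size (sort_sexp s) + sexp_size (enc_symbol s) <= symbol_bound.
Proof.
rewrite /symbol_bound;
  elim: all_symbols (In_all_symbols s) => //= s' l IHl [->|/IHl le_s].
  exact: leq_addr.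
exact: leq_trans le_s (leq_addl _ _).
Qed.

Definition arity_bound : nat :=
  \sum_(R : relsym tau) rel_ar R + \sum_(f : funsym tau) fun_ar f + k.

Lemma rel_ar_bound R : @rel_ar tau R <= arity_bound.
Proof. by rewrite /arity_bound (bigD1 R) //=; lia. Qed.

Lemma fun_ar_bound f : @fun_ar tau f <= arity_bound.
Proof. by rewrite /arity_bound [X in _ + X + _](bigD1 f) //=; lia. Qed.

Section Example.
Variables (r : nat) (e : example tau r).
Notation A := (ex_struct e).
Notation s := (sexp_size (enc_example e)).

Lemma dom_bound : #|A| < s.
Proof. by rewrite /= size_enc_nat; lia. Qed.

Lemma answers_bound : #|ex_answers e| < s.
Proof.
rewrite cardE -(size_map (@enc_tuple _ r)).
apply: leq_trans (size_enc_seq _) _.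
exact: (size_cdr (enc_example e)).
Qed.

Lemma rel_bound R : #|rel_int A R| < s.
Proof.
rewrite cardE -(size_map (@enc_tuple _ _)).
apply: leq_trans (size_enc_seq _) _.
have /sexp_size_unlist lt_R : enc_tuples (rel_int A R) \in
    unlist (car (cdr (car (enc_example e)))).
  by rewrite enc_seqK; apply: (map_f (fun R => enc_tuples _)); rewrite mem_enum.
apply: leq_trans (ltnW lt_R) _; apply: leq_trans (size_car _) _.
by apply: leq_trans (size_cdr _) _; apply: size_car.
Qed.

(** The encoding writes out the full graph of every function, one entry per tuple. *)
Lemma fun_bound (f : funsym tau) : #|{: (fun_ar f).-tuple A}| < s.
Proof.
rewrite cardT; pose g (a : (fun_ar f).-tuple A) :=
  Cons (enc_tuple a) (enc_elt (fun_int a)).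
rewrite -(size_map g); apply: leq_trans (size_enc_seq _) _.
have /sexp_size_unlist lt_f : enc_seq [seq g a | a <- enum {: (fun_ar f).-tuple
  A}] \in
    unlist (cdr (cdr (car (enc_example e)))).
  rewrite enc_seqK; apply: (map_f (fun f => enc_seq [seq Cons (enc_tuple a)
    (enc_elt (@fun_int _ A _ a)) | a <- enum {: (fun_ar f).-tuple A}])).
  by rewrite mem_enum.
apply: leq_trans (ltnW lt_f) _; apply: leq_trans (size_cdr _) _.
by apply: leq_trans (size_cdr _) _; apply: size_car.
Qed.

Lemma point_bound (v : assignment k A) : sexp_size (point v) <= s + k * s.*2 +
  2.
Proof.
rewrite /point /= -/(enc_example e).
have le_elt : {in [seq enc_elt (v i) | i <- enum 'I_k], forall x,
  sexp_size x <= s.*2.-1}.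
  move=> _ /mapP[i _ ->]; rewrite /enc_elt size_enc_nat.
  by have := leq_trans (ltn_ord (enum_rank (v i))) (ltnW dom_bound); lia.
have := enc_seq_le le_elt; rewrite size_map size_enum_ord prednK; last first.
  by have := dom_bound; lia.
by rewrite /enc_asg; rewrite /=; lia.
Qed.

End Example.

Variable I : instance tau k.
Notation r := (arity I).
Notation exs := (examples I).
Notation G := (inst_grammar I).
Notation Es := [seq enc_example e | e <- exs].
Notation pts := (points k Es).
Notation ks := (keys k #|nonterm G| pts).
Notation s := (sexp_size (enc_instance I)).

Lemma examples_bound : size exs < s.
Proof.
rewrite -(size_map (@enc_example tau r)); apply: leq_trans (size_enc_seq _) _.
by apply: leq_trans (size_cdr (enc_instance I)); apply: (size_car (cdr _)).
Qed.

Lemma example_bound e : List.In e exs -> sexp_size (enc_example e) < s.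
Proof.
move=> e_exs; apply: leq_trans (enc_seq_mem (mem_In (@enc_example tau r)
  e_exs)) _.
by apply: leq_trans (size_cdr (enc_instance I)); apply: (size_car (cdr _)).
Qed.

Lemma nonterm_bound : #|nonterm G| < s.
Proof.
have : sexp_size (enc_nat #|nonterm G|) <= s.
  apply: leq_trans (size_cdr (enc_instance I)).
  apply: leq_trans (size_cdr (cdr (enc_instance I))).
  exact: (size_car (cdr (cdr (enc_instance I)))).
by apply: leq_trans; rewrite size_enc_nat ltnS -addnn leq_addr.
Qed.

Lemma enc_rules_bound : sexp_size (enc_seq (enc_rules G)) <= s.
Proof.
apply: leq_trans (size_cdr (enc_instance I)).
apply: leq_trans (size_cdr (cdr (enc_instance I))).
apply: leq_trans (size_cdr (cdr (cdr (enc_instance I)))).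
exact: (size_cdr (cdr (cdr (cdr (enc_instance I))))).
Qed.

Lemma rules_bound : size (enc_rules G) < s.
Proof. exact: leq_trans (size_enc_seq _) enc_rules_bound. Qed.

Lemma rule_bound rl : rl \in enc_rules G -> sexp_size (cdr rl) < s.
Proof.
move=> rl_in; apply: leq_ltn_trans (size_cdr rl) _.
exact: leq_trans (enc_seq_mem rl_in) enc_rules_bound.
Qed.

(** At most [s] examples with at most [s ^ k] assignments each: polynomial because [k] is fixed. *)
Lemma points_bound : size pts <= s ^ k.+1.
Proof.
have le_ex e : List.In e exs ->
  size (words k (range (dom_size (enc_example e)))) <= s ^ k.
  move=> e_exs; rewrite size_words size_range (enc_exampleE e).2 leq_expl //.
  by have := dom_bound e; have := example_bound e_exs; lia.
apply: (@leq_trans (size exs * s ^ k));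
  last by rewrite expnS leq_mul // ltnW ?examples_bound.
rewrite /points; elim: exs le_ex => //= e es IHes le_ex.
rewrite size_cat size_map mulSn leq_add ?le_ex //; first by left.
by apply: IHes => e' e'_es; apply: le_ex; right.
Qed.

(** Collects all constants depending on [tau] and [k], so that [u] dominates every linear term met
    below and the remaining inequalities are left to linear arithmetic. *)
Definition size_factor : nat := k + symbol_bound + arity_bound + 10.

Local Notation u := (size_factor * s).

Lemma s_gt0 : 0 < s. Proof. exact: sexp_size_gt0. Qed.

Lemma unit_bounds :
  [/\ 10 * s <= u, k * s <= u, arity_bound * s <= u & symbol_bound <= u].
Proof.
have s0 := s_gt0; rewrite /size_factor; move: s s0 => n n0.
by split; rewrite ?mulnDl; try lia; have := leq_pmulr symbol_bound n0; lia.
Qed.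

Lemma example_le_bound N e : List.In e exs -> 4 * u <= N ->
  @example_le tau k r N e.
Proof.
move=> e_exs le_N; have [le_s le_ks le_as _] := unit_bounds.
have lt_e := example_bound e_exs; have s0 := s_gt0.
have le_tup n (a : n.-tuple (ex_struct e)) : n <= arity_bound ->
  sexp_size (enc_tuple a) <= N.
  move=> le_n; apply: leq_trans (enc_tuple_le a (ltn_trans (dom_bound e) lt_e))
    _.
  have : n * s.*2 <= arity_bound * s.*2 by rewrite leq_mul2r le_n orbT.
  by rewrite -!muln2 !mulnA; lia.
split.
- by have := dom_bound e; lia.
- move=> v; apply: leq_trans (point_bound v) _.
  have : k * (sexp_size (enc_example e)).*2 <= k * s.*2.
    by rewrite leq_mul2l leq_double ltnW ?orbT.
  by rewrite -!muln2 !mulnA; lia.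
- move=> R; split; first by have := rel_bound e R; lia.
  by move=> a; apply: le_tup; apply: rel_ar_bound.
- move=> f; split; first by have := fun_bound e f; lia.
  by move=> a; apply: le_tup; apply: fun_ar_bound.
Qed.

Lemma key_bound key : key \in ks -> sexp_size key <= 6 * u + size pts * (4 * u).
Proof.
have [le_s le_ks le_as _] := unit_bounds; have s0 := s_gt0.
case/allpairsP=> -[x1 x2] /= [/mem_range[j lt_j ->] H ->].
case/allpairsP: H => -[y1 y2] /= [y1_in H ->].
case/allpairsP: H => -[z1 z2] /= [/mem_words[l -> [size_l l_in]] z2_in ->].
have le_y1 : sexp_size y1 <= 3 by move: y1_in; rewrite !inE => /orP[] /eqP->.
have le_z1 : sexp_size (enc_seq l) <= k * 4 + 1.
  rewrite -size_l; apply: enc_seq_le => y /l_in.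
  by rewrite !inE => /orP[] /eqP->.
have le_z2 : sexp_size z2 <= size pts * (4 * u) + 1.
  apply: size_table z2_in => p /point_pts[e [v [e_exs ->]]].
  rewrite (enc_exampleE e).2.
  have := point_bound v; have := dom_bound e; have lt_e := example_bound e_exs.
  have : k * (sexp_size (enc_example e)).*2 <= k * s.*2.
    by rewrite leq_mul2l leq_double ltnW ?orbT.
  by rewrite -!muln2 !mulnA; lia.
have lt_n := nonterm_bound; have le_k : k <= k * s by rewrite leq_pmulr.
suff : (sexp_size (enc_nat j) + (sexp_size y1 + (sexp_size (enc_seq l) +
  sexp_size z2).+1).+1).+1 <= 6 * u + size pts * (4 * u) by [].
have lt_js := ltn_trans lt_j lt_n.
move: (size pts * _) le_z2 => m le_z2.
move: (size_factor * s) (k * s) s le_s le_ks s0 le_k lt_js => a b c *.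
rewrite size_enc_nat; lia.
Qed.

Lemma ltn_exp2 n : n < 2 ^ n.
Proof. exact: ltn_expl. Qed.

(** Each factor is bounded by a power of two; in particular [s ^ size pts] is at most
    [2 ^ (s * size pts)], which puts the number of keys into the form [2 ^ poly]. *)
Lemma keys_exp_bound : (#|nonterm G| * (2 * (2 ^ k * s ^ size pts))).+1 <=
  2 ^ (u + u + s * size pts).
Proof.
have [le_s le_ks _ _] := unit_bounds; have s0 := s_gt0.
apply: leq_trans (_ : _ <= (2 ^ s * (2 * (2 ^ k * 2 ^ (s * size pts)))).+1) _.
  rewrite ltnS.
  apply: leq_mul; first exact: ltnW (ltn_trans nonterm_bound (ltn_exp2 _)).
  do 2 (apply: leq_mul => //).
  by rewrite expnM leq_expl // ltnW // ltn_exp2.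
rewrite -expnD -expnS -expnD.
have : 2 ^ (s + (k + (s * size pts)).+1).+1 <= 2 ^ (u + u + s * size pts).
  rewrite leq_pexp2l //; have : k <= k * s by rewrite leq_pmulr.
  lia.
apply: leq_trans; rewrite expnS mul2n -addnn -addn1 leq_add2l expn_gt0 //.
Qed.

(** Origin of the exponent: [u ^ k.+1] bounds the number of points; the next factor covers
    [s * size pts], the leading term in the logarithm of the number of keys; the third absorbs the
    other terms of that logarithm; the last is the size of a right-hand side, the exponent in the
    number of its evaluations. Since [u] is at least 10, each factor also absorbs numerical
    constants. *)
Lemma safe_main_bound :
  safe (2 ^ (u ^ k.+4)) (c_main tau k) (enc_instance I).
Proof.
have [le_s le_ks le_as le_sym] := unit_bounds; have s0 := s_gt0.
have u10 : 10 <= u by lia.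
have u0 : 0 < u by lia.
set p1 := u ^ k.+1.
have le_up1 : u <= p1 by rewrite /p1 -{1}[u]expn1 leq_pexp2l.
have le_L : size pts <= p1.
  by apply: leq_trans points_bound _; rewrite leq_expl //; lia.
have le_k1 : u ^ k <= p1 by rewrite leq_pexp2l.
have p4E : u ^ k.+4 = u * (u * (u * p1)) by rewrite 3!expnS.
have le_sL : s * size pts <= u * p1 by rewrite leq_mul //; lia.
have le_uL : size pts * (4 * u) <= 4 * (u * p1).
  by rewrite mulnCA leq_mul2l /= mulnC leq_mul2l le_L orbT.
have le_sizes := keys_exp_bound; have le_key := key_bound.
set p2 := u * p1; set p3 := u * p2; set p4 := u * p3.
rewrite -/p2 -/p3 -/p4 in p4E le_sL le_uL.
have le_12 : 10 * p1 <= p2 by apply: leq_mul.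
have le_23 : 10 * p2 <= p3 by apply: leq_mul.
have le_34 : 10 * p3 <= p4 by apply: leq_mul.
have le_ss : s * p3 <= p4 by apply: leq_mul => //; lia.
set N := 2 ^ _.
have NE : N = 2 ^ p4 by rewrite /N p4E.
have le_N x : x <= p4 -> x <= N.
  by move=> le_x; apply: leq_trans le_x _; rewrite NE ltnW // ltn_exp2.
have {}le_sizes : (#|nonterm G| * (2 * (2 ^ k * s ^ size pts))).+1 <= 2 ^ p3.
  by apply: leq_trans le_sizes _; rewrite leq_pexp2l //; lia.
have dom_lt (e : example tau r) : List.In e exs -> #|ex_struct e| < s.
  by move=> e_exs; apply: ltn_trans (dom_bound e) (example_bound e_exs).
have ks_exp : (size ks).+1 <= 2 ^ p3.
  apply: leq_trans le_sizes; rewrite ltnS; apply: size_keys.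
  move=> p /point_pts[e [v [e_exs ->]]]; rewrite (enc_exampleE e).2.
  exact: dom_lt.
have k_le : k <= k * s by rewrite leq_pmulr.
apply: safe_main; first by rewrite -muln2; apply: le_N; lia.
move=> le_rk; apply: (@safe_solve _ _ _ _ s le_rk).
- by move=> e e_exs; apply: example_le_bound => //; apply: le_N; lia.
- by move=> x; have := symbol_boundP x => ?; apply: le_N; lia.
- by move=> x; have := symbol_boundP x => ?; apply: le_N; lia.
- exact: dom_lt.
- move=> e e_exs; apply: le_N.
  by have := answers_bound e; have := example_bound e_exs; lia.
- move=> e a e_exs; apply: leq_trans (enc_tuple_le a (dom_lt e e_exs)) _.
  apply: le_N; have : r * s.*2 <= k * s.*2 by rewrite leq_mul2r le_rk orbT.
  by rewrite -!muln2 !mulnA; lia.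
- by apply: le_N; lia.
- exact: s_gt0.
- apply: le_N; have : s ^ k <= u ^ k by rewrite leq_expl //; lia.
  lia.
- apply: le_N; have : 3 ^ k <= u ^ k by rewrite leq_expl //; lia.
  lia.
- by apply: le_N; lia.
- by apply: le_N; have := examples_bound; lia.
- by apply: le_N; lia.
- apply: leq_trans (ltnW le_sizes) _; rewrite NE leq_pexp2l //; lia.
- by move=> key /le_key le_k; apply: le_N; lia.
(* The dominant requirement: at most [2 ^ p3] choices raised to a size below [s], whence [s * p3] in
   the exponent. *)
- move=> rl rl_in; apply: leq_trans (leq_expl _ ks_exp) _.
  rewrite -expnM NE leq_pexp2l // mulnC; apply: leq_trans le_ss.
  by rewrite leq_mul2r ltnW ?rule_bound ?orbT.
- by move=> rl rl_in; apply: le_N; have := rule_bound rl_in; lia.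
- by apply: le_N; have := rules_bound; lia.
Qed.

End Bounds.

Theorem theorem5p3 (tau : signature) (k : nat) :
  exists (P : program) (c : nat), forall I : instance tau k,
    exists (o : option (formula tau k)) (t : nat),
      [/\ runs P (enc_instance I) (enc_output o) t,
          t <= 2 ^ (c * sexp_size (enc_instance I) ^ c + c) &
          correct_output I o].
Proof.
have [P [d run_P]] := compile_program (c_main tau k).
(* The time bound [d * N ^ d], with [d] at most [2 ^ d], has exponent at most [b * s ^ k.+4 + d] for
   input size [s]. The sum [b + d + k.+4] serves as coefficient, exponent and additive constant at
   the same time. *)
pose b := d * size_factor tau k ^ k.+4.
exists P, (b + d + k.+4) => I.
have [o oE o_ok] := main_correct I.
have N0 : 0 < 2 ^ (size_factor tau k * sexp_size (enc_instance I)) ^ k.+4.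
  by rewrite expn_gt0.
have [t run_t le_t] := run_P _ _ N0 (safe_main_bound I).
exists o, t; split=> //; first by rewrite -oE.
apply: leq_trans le_t _; rewrite -expnM expnMn.
have s0 := s_gt0 I; move: (sexp_size _) s0 => s s0.
apply: leq_trans (leq_mul (ltnW (ltn_exp2 d)) (leqnn _)) _.
rewrite -expnD leq_pexp2l //.
have : s ^ k.+4 <= s ^ (b + d + k.+4) by rewrite leq_pexp2l // leq_addl.
have -> : size_factor tau k ^ k.+4 * s ^ k.+4 * d = b * s ^ k.+4.
  by rewrite mulnC mulnA.
clearbody b; move: (s ^ (b + d + k.+4)) (s ^ k.+4) => y x le_xy.
have : b * x <= (b + d + k.+4) * y by apply: leq_mul => //;
  rewrite -addnA leq_addr.
move: ((b + d + k.+4) * y) (b * x) => m n le_nm.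
by rewrite addnC leq_add // addnAC leq_addl.
Qed.
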